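(* For $N\ge 2$ let $\omega=2\pi/N$, let $\{\mathbf{T}_n\}_{0\le n<N}$ be the minimal Hermite-type basis of $\mathbb{R}^N$ (these vectors depend on $N$), and define vectors $\{\mathbf{\Psi}_n\}_{n\ge 0}$ in $\mathbb{R}^N$ by $$\mathbf{\Psi}_n(k)=\sqrt[4]{\omega}\;\psi_n(\sqrt{\omega}\,k),\qquad k\in I_N.$$ Then it is possible to choose the signs of the vectors $\mathbf{T}_n$ in such a way that for every $n\ge 0$ and any $\epsilon>0$ we have $\|\mathbf{T}_n-\mathbf{\Psi}_n\|=O(N^{-1+\epsilon})$ as $N\to+\infty$.
   Context: Let $I_N=\{k\in\mathbb{Z}: -\lceil N/2\rceil+1\le k\le\lfloor N/2\rfloor\}$. Entries of a vector $\mathbf{a}\in\mathbb{C}^N$ (or $\mathbb{R}^N$) are labelled by $I_N$, and $\mathbf{a}$ is identified with the $N$-periodic function on $\mathbb{Z}$ that agrees with it on $I_N$. The dot product is $\langle\mathbf{a},\mathbf{b}\rangle=\sum_{k\in I_N}\mathbf{a}(k)\mathbf{b}(k)$ and $\|\mathbf{a}\|=\sqrt{\langle\mathbf{a},\bar{\mathbf{a}}\rangle}$. The Hermite functions are $\psi_n(x)=(-1)^n(\sqrt{\pi}\,2^n n!)^{-1/2}e^{x^2/2}\frac{\mathrm{d}^n}{\mathrm{d}x^n}e^{-x^2}$, $n\ge 0$. The (centered) discrete Fourier transform is the linear map $\mathscr{F}$ on $\mathbb{C}^N$ given by $(\mathscr{F}\mathbf{a})(l)=\frac{1}{\sqrt{N}}\sum_{k\in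 I_N}e^{-\mathrm{i}\omega kl}\mathbf{a}(k)$, $l\in I_N$, with $\omega=2\pi/N$. For a nonzero vector $\mathbf{a}$, $\operatorname{width}(\mathbf{a})$ is the integer $n\in\{0,1,\dots,\lfloor N/2\rfloor\}$ such that $\mathbf{a}(n)\ne 0$ or $\mathbf{a}(-n)\neq 0$, but $\mathbf{a}(k)=0$ whenever $n<|k|\le\lfloor N/2\rfloor$ (with $\mathbf{a}$ viewed as an $N$-periodic function). The minimal Hermite-type basis of $\mathbb{R}^N$ is the family $\{\mathbf{T}_n\}_{0\le n<N}$ of vectors in $\mathbb{R}^N$, unique up to the sign of each vector, such that: (a) each $\mathbf{T}_n$ is an eigenvector of $\mathscr{F}$, with $\mathscr{F}\mathbf{T}_n=(-\mathrm{i})^n\mathbf{T}_n$ for $0\le n<N-1$; (b) $\{\mathbf{T}_n\}_{0\le n<N}$ is an orthonormal basis of $\mathbb{R}^N$; (c) $\operatorname{width}(\mathbf{T}_n)\le\lfloor(N+n+2)/4\rfloor$ for $0\le n<N$. (Existence and uniqueness up to signs hold for every $N\ge2$.) For fixed $n$, $\mathbf{T}_n$ is defined for all $N>n$. Implied constants in $O(\cdot)$ may depend on $n$ and $\epsilon$. *)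

(* Defs.v *)
From HB Require Import structures.
From mathcomp Require Import all_boot all_order all_algebra.
From mathcomp Require Import complex.
From mathcomp Require Import all_classical all_reals all_analysis.
Import Order.TTheory GRing.Theory Num.Theory.
Import numFieldNormedType.Exports.

Set Implicit Arguments.
Unset Strict Implicit.
Unset Printing Implicit Defensive.

Local Open Scope classical_set_scope.
Local Open Scope ring_scope.

(* The increasing enumeration of
   I_N = {- ceil(N/2) + 1, ..., floor(N/2)}; ceil(N/2) is uphalf N. A vector
   indexed by I_N is a row vector whose j-th entry carries the label lab j. *)
Definition lab (N : nat) (j : 'I_N) : int := j%:Z - (uphalf N)%:Z + 1.

(* The N-periodic function on the integers which agrees with a on I_N; the
   default value 0 is only used for N = 0. *)
Definition pext (K : nmodType) (N : nat) (a : 'rV[K]_N) (k : int) : K :=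
  if [pick j : 'I_N | (lab j == k %[mod N])%Z] is Some j then a 0 j else 0.

(* Bilinear: no conjugation, also over the complex numbers. *)
Definition dot (K : pzRingType) (N : nat) (a b : 'rV[K]_N) : K :=
  \sum_k a 0 k * b 0 k.

(* Only needed for real vectors, where conjugation is trivial. *)
Definition vnorm (R : realType) (N : nat) (a : 'rV[R]_N) : R :=
  Num.sqrt (dot a a).

Definition omega (R : realType) (N : nat) : R := 2 * pi / N%:R.

Definition hermite (R : realType) (n : nat) (x : R) : R :=
  (-1) ^+ n * (Num.sqrt (Num.sqrt pi * 2 ^+ n * n`!%:R))^-1 * expR (x ^+ 2 / 2)
  * derive1n n (fun y : R => expR (- y ^+ 2)) x.

(* exp (i t) *)
Definition cis (R : realType) (t : R) : R[i] := (cos t +i* sin t)%C.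

Definition dft (R : realType) (N : nat) (a : 'rV[R[i]]_N) : 'rV[R[i]]_N :=
  \row_l (((Num.sqrt N%:R)^-1)%:C%C *
          \sum_k cis (- (omega R N * (lab k)%:~R * (lab l)%:~R)) * a 0 k).

Definition complexify (R : realType) (N : nat) (a : 'rV[R]_N) : 'rV[R[i]]_N :=
  map_mx (fun x : R => x%:C%C) a.

Definition dft_eigenvector (R : realType) (N : nat) (a : 'rV[R[i]]_N) : Prop :=
  a != 0 /\ exists lambda : R[i], dft a = lambda *: a.

Definition is_width (K : nmodType) (N : nat) (a : 'rV[K]_N) (n : nat) : Prop :=
  [/\ (n <= N./2)%N,
      pext a n%:Z <> 0 \/ pext a (- n%:Z) <> 0
    & forall k : int, n%:Z < `|k| <= (N./2)%:Z -> pext a k = 0].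

(* The unique n with is_width a n when a is nonzero; 0 for the zero vector. *)
Definition width (K : nmodType) (N : nat) (a : 'rV[K]_N) : nat :=
  xget 0%N [set n | is_width a n].

(* Only the members T n with n < N are constrained. *)
Definition minimal_hermite_basis (R : realType) (N : nat) (T : nat -> 'rV[R]_N)
    : Prop :=
  [/\ (forall n, (n < N)%N -> dft_eigenvector (complexify (T n))),
      (forall n, (n < N.-1)%N ->
         dft (complexify (T n)) = (- 'i%C) ^+ n *: complexify (T n)),
      basis_of fullv [seq T n | n <- iota 0 N],
      (forall m n, (m < N)%N -> (n < N)%N -> dot (T m) (T n) = (m == n)%:R)
    & (forall n, (n < N)%N -> (width (T n) <= (N + n + 2) %/ 4)%N)].

Definition Psi (R : realType) (N n : nat) : 'rV[R]_N :=
  \row_k (omega R N `^ 4^-1 * hermite n (Num.sqrt (omega R N) * (lab k)%:~R)).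

(* Main.v *)
Require Import Defs.
From mathcomp Require Import all_boot all_order all_algebra.
From mathcomp Require Import complex.
From mathcomp Require Import all_classical all_reals all_analysis.
From mathcomp Require Import ring lra zify.
Import Order.TTheory GRing.Theory Num.Theory.
Import numFieldNormedType.Exports.

(** Fix n, let b be its parity and D = n/2 + 1 with rounding down. The theorem
holds with the better error O(1/N): every error term below is O(omega) with
omega = 2 pi / N.

Shape of the basis vectors. The eigenvalue of T n is real or purely imaginary,
so the eigenvalue equation says that T n is plus or minus its own cosine or
sine transform. As T n vanishes at the labels of absolute value larger than w =
(N + n + 2)/4, again rounded down, that transform is a trigonometric
polynomial: T n (l) = sin^b (omega l) times a polynomial p in cos (omega l) of
degree at most w - b. Vanishing between w and m = (N - b)/2, rounded down,
provides m - w distinct roots of p, and only a cofactor of degree at most D is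
left. Divided by its value at the origin, the product over the roots is the
window, whose factors are 1 - sin^2 (pi x / N) / sin^2 (pi j / N). Its
logarithm is close to - sin^2 (pi x / N) * sum_j sin^-2 (pi j / N), the sum
telescopes up to small errors because - sin^-2 is the derivative of the
cotangent, and the result is that the window is close to exp (- omega x^2 / 2)
([window_approx]). The cofactor, written in the variable 4 sin^2 (pi x / N) /
omega, which is close to omega x^2, is expanded along the even or odd Hermite
polynomials. So T n is a linear combination of D + 1 vectors [windowed_Psi],
and these are within O(omega) of the sampled Hermite functions of index 2 j + b
for j <= D ([window_expansion], [vnorm_windowed_Psi]).

The excess degree. The index 2 D + b is n + 2. To exclude it, the top
coefficient of p is computed in two ways: from the cofactor, and from the
transform, where only the two labels w and - w contribute. The second
computation makes it a multiple of T n (w), hence of the cofactor at a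
height of size 1/omega, and the sign of the eigenvalue is such that the two
results would have opposite signs if the top Hermite polynomial dominated.
Hence its coefficient is O(omega) ([top_coef_bound]).

Identification. The Gram matrix of the sampled Hermite functions is the
identity up to O(omega): the midpoint rule turns derivatives of
polynomials times exp (- x^2) into negligible sums, and Gaussian integration by
parts reduces every product of Hermite polynomials to the sum of exp (- x^2)
itself ([dot_Psi]). By strong induction on n, the orthogonality of T n to
T (n - 2), T (n - 4), ... makes the lower coefficients O(omega). The only
coefficient that remains is the one of index n; the normalisation of T n forces
its absolute value to be 1 + O(omega), and its sign is the one to be chosen
([basis_near_Psi]). *)

Set Implicit Arguments.
Unset Strict Implicit.
Unset Printing Implicit Defensive.

Local Open Scope classical_set_scope.
Local Open Scope ring_scope.

(** * Elementary estimates *)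

Section Calculus.
Variable R : realType.
Implicit Types (f g : R -> R) (x y : R).

Lemma is_derive_add f g x (a b : R) : is_derive x 1 f a -> is_derive x 1 g b ->
  is_derive x 1 (fun y => f y + g y) (a + b).
Proof. by move=> fa gb; exact: is_deriveD. Qed.

Lemma is_derive_sub f g x (a b : R) : is_derive x 1 f a -> is_derive x 1 g b ->
  is_derive x 1 (fun y => f y - g y) (a - b).
Proof. by move=> fa gb; exact: is_deriveB. Qed.

Lemma is_derive_mul f g x (a b : R) : is_derive x 1 f a -> is_derive x 1 g b ->
  is_derive x 1 (fun y => f y * g y) (f x * b + g x * a).
Proof. by move=> fa gb; exact: is_deriveM. Qed.

Lemma is_derive_chain f g x (a b : R) : is_derive x 1 g b ->
  is_derive (g x) 1 f a -> is_derive x 1 (fun y => f (g y)) (a * b).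
Proof. by move=> gb fa; exact: is_derive1_comp. Qed.

Lemma is_derive_horner (p : {poly R}) x :
  is_derive x 1 (fun y => p.[y]) p^`().[x].
Proof. exact: is_derive_poly. Qed.

Lemma is_derive_pow n x : is_derive x 1 (fun y : R => y ^+ n) (n%:R * x ^+ n.-1).
Proof.
have -> : (fun y : R => y ^+ n) = (fun y => ('X^n : {poly R}).[y]).
  by apply/funext => y; rewrite hornerXn.
apply: (is_derive_eq (is_derive_horner _ _)).
by rewrite derivXn hornerMn hornerXn mulr_natl.
Qed.

Lemma is_derive_scale (k : R) f x (a : R) : is_derive x 1 f a ->
  is_derive x 1 (fun y => k * f y) (k * a).
Proof. by move=> fa; exact: is_deriveZ. Qed.

Lemma is_derive_gauss x :
  is_derive x 1 (fun y : R => expR (- y ^+ 2)) (- (2 * x * expR (- x ^+ 2))).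
Proof.
have h : is_derive x 1 (fun y : R => (- 'X^2 : {poly R}).[y]) (- (2 * x)).
  apply: (is_derive_eq (is_derive_horner _ _)).
  by rewrite derivN derivXn !hornerE /= -mulr_natl; ring.
have -> : (fun y : R => expR (- y ^+ 2)) =
    (fun y => expR ((- 'X^2 : {poly R}).[y])).
  by apply/funext => y; rewrite !hornerE.
apply: (is_derive_eq (is_derive_chain h (is_derive_expR _))).
by rewrite !hornerE; ring.
Qed.

Lemma derive_within_continuous f (df : R -> R) (A : set R) :
  (forall x, is_derive x 1 f (df x)) -> {within A, continuous f}.
Proof.
move=> fdf; apply: continuous_subspaceT => x.
by have dx := fdf x; exact/differentiable_continuous/derivable1_diffP/ex_derive.
Qed.

Lemma mean_value f (df : R -> R) x y : x <= y ->
  (forall x, is_derive x 1 f (df x)) ->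
  exists2 c, x <= c <= y & f y - f x = df c * (y - x).
Proof.
move=> xy fdf; have [c] := MVT_segment xy (fun z _ => fdf z) (derive_within_continuous fdf).
by rewrite in_itv /= => ? ?; exists c.
Qed.

Lemma derive_ge0_le f (df : R -> R) x y : x <= y ->
  (forall x, is_derive x 1 f (df x)) ->
  (forall c, x <= c <= y -> 0 <= df c) -> f x <= f y.
Proof.
move=> xy fdf df0; have [c cxy e] := mean_value xy fdf.
by rewrite -subr_ge0 e mulr_ge0 ?subr_ge0 ?df0.
Qed.

Lemma derive_bound f (df : R -> R) (K : R) x y : x <= y ->
  (forall x, is_derive x 1 f (df x)) ->
  (forall c, x <= c <= y -> `|df c| <= K) -> `|f y - f x| <= K * (y - x).
Proof.
move=> xy fdf dfK; have [c cxy ->] := mean_value xy fdf.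
by rewrite normrM [`|y - x|]ger0_norm ?subr_ge0// ler_wpM2r ?subr_ge0 ?dfK.
Qed.

Lemma lip1 f (df : R -> R) x y : (forall x, is_derive x 1 f (df x)) ->
  (forall c, `|df c| <= 1) -> `|f y - f x| <= `|y - x|.
Proof.
move=> fdf dfK; wlog xy : x y / x <= y => [hw|].
  by have [/hw//|/ltW/hw] := leP x y; rewrite distrC [leRHS]distrC.
by rewrite -[leRHS]mul1r [`|y - x|]ger0_norm ?subr_ge0//; apply: derive_bound fdf _.
Qed.

Lemma lip_sin x y : `|sin y - sin x| <= `|y - x|.
Proof.
by apply: (lip1 (df := cos)) => c; exact: cos_max.
Qed.

Lemma lip_cos x y : `|cos y - cos x| <= `|y - x|.
Proof.
by apply: (lip1 (df := fun x => - sin x)) => c; rewrite normrN sin_max.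
Qed.

Lemma sin_le x : 0 <= x -> sin x <= x.
Proof.
by move=> x0; have := lip_sin 0 x; rewrite sin0 !subr0 (ger0_norm x0); apply/le_trans/ler_norm.
Qed.

Lemma cos_ge x : 0 <= x -> 1 - x ^+ 2 / 2 <= cos x.
Proof.
move=> x0; have d y : is_derive y 1 (fun z : R => cos z + 2^-1 * z ^+ 2)
    (- sin y + 2^-1 * (2 * y ^+ 1)).
  by apply: is_derive_add; apply: is_derive_scale; exact: is_derive_pow.
have := derive_ge0_le x0 d; rewrite cos0 expr0n mulr0 addr0.
rewrite -lerBlDr mulrC => h; apply: h => c /andP[c0 _].
by rewrite expr1; have := sin_le c0; lra.
Qed.

Lemma sin_ge x : 0 <= x -> x - x ^+ 3 / 6 <= sin x.
Proof.
move=> x0; have d y : is_derive y 1 (fun z : R => sin z - z + 6^-1 * z ^+ 3)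
    (cos y - 1 + 6^-1 * (3 * y ^+ 2)).
  apply: is_derive_add; apply: is_derive_scale; exact: is_derive_pow.
have := derive_ge0_le x0 d; rewrite sin0 expr0n mulr0 addr0 subr0.
suff h (c : R) : 0 <= c -> 0 <= cos c - 1 + 6^-1 * (3 * c ^+ 2).
  by move=> /(_ (fun c cx => h c (proj1 (andP cx)))); lra.
by move=> c0; have := cos_ge c0; lra.
Qed.

Lemma sin_approx x : `|sin x - x| <= `|x| ^+ 3.
Proof.
wlog x0 : x / 0 <= x => [hw|].
  have [/hw//|/ltW x0] := leP 0 x.
  have := hw (- x); rewrite sinN oppr_ge0 x0 normrN.
  by rewrite (_ : - sin x - - x = - (sin x - x)) ?normrN; [exact|ring].
have := sin_le x0; have := sin_ge x0; have := exprn_ge0 3 x0.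
by rewrite (ger0_norm x0) ler_norml; lra.
Qed.

Lemma sin_abs_le x : `|sin x| <= `|x|.
Proof. by have := lip_sin 0 x; rewrite sin0 !subr0. Qed.

Lemma sin_ge_third x : 0 <= x <= 2 -> x / 3 <= sin x.
Proof.
case/andP=> x0 x2; apply: le_trans (sin_ge x0).
have : 0 <= x * (4 - x ^+ 2) by apply: mulr_ge0 => //; nra.
by lra.
Qed.

Lemma pi_lt4 : pi < 4 :> R.
Proof. by have := @pihalf_lt2 R; lra. Qed.

(** Mean value bound for the exponential; m is any common lower bound, so that the
decay of the slower exponential is kept as a factor. *)
Lemma expR_dist (a b m : R) : m <= a -> m <= b ->
  `|expR (- a) - expR (- b)| <= `|a - b| * expR (- m).
Proof.
wlog ab : a b / a <= b => [hw ma mb|ma _].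
  have [ab|/ltW ba] := leP a b; first exact: hw.
  by rewrite distrC [`|a - b|]distrC hw.
have h : expR (- b) <= expR (- a) by rewrite ler_expR lerN2.
rewrite ger0_norm ?subr_ge0// distrC ger0_norm ?subr_ge0//.
apply: (@le_trans _ _ ((b - a) * expR (- a))); last first.
  by rewrite ler_wpM2l ?subr_ge0// ler_expR lerN2.
have -> : expR (- b) = expR (- a) * expR (a - b) by rewrite -expRD; congr expR; ring.
have := expR_ge1Dx (a - b); have := expR_gt0 (- a); nra.
Qed.

(** The factor of the window is compared with an exponential from below; together
with 1 - u <= exp (- u) this traps the logarithm up to 2 u^2. *)
Lemma one_sub_ge_expR (u : R) : 0 <= u <= 2^-1 ->
  expR (- (u + 2 * u ^+ 2)) <= 1 - u.
Proof.
case/andP=> u0 u1; rewrite expRN; have h := expR_ge1Dx (u + 2 * u ^+ 2).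
have p : 0 < 1 + (u + 2 * u ^+ 2) by nra.
apply: (@le_trans _ _ (1 + (u + 2 * u ^+ 2))^-1).
  by rewrite lef_pV2 ?posrE ?expR_gt0.
rewrite -div1r ler_pdivrMr// -subr_ge0.
rewrite (_ : _ - _ = u ^+ 2 * (1 - 2 * u)); last by ring.
by apply: mulr_ge0; [exact: sqr_ge0 | lra].
Qed.

Lemma poly_growth (p : {poly R}) : exists K m, 0 <= K /\
  forall x, `|p.[x]| <= K * (1 + x ^+ 2) ^+ m.
Proof.
elim/poly_ind: p => [|p c [K [m [K0 hK]]]].
  by exists 0, 0%N; split => // x; rewrite horner0 normr0 mul0r.
exists (K + `|c|), m.+1; split; first by rewrite addr_ge0.
move=> x; rewrite !hornerE; apply: le_trans (ler_normD _ _) _.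
have x1 : 1 <= 1 + x ^+ 2 by rewrite lerDl sqr_ge0.
rewrite mulrDl lerD//; last first.
  by rewrite ler_peMr// exprn_ege1.
rewrite normrM exprSr mulrA ler_pM// -ler_sqr ?nnegrE//; last by lra.
by rewrite real_normK ?num_real//; have := sqr_ge0 x; nra.
Qed.

(** A single term of the exponential series at c (1 + x^2) beats the power, and
shifting by 1 costs only the constant factor exp c. *)
Lemma pow_expR_bounded (c : R) m : 0 < c -> exists C, 0 <= C /\
  forall x, (1 + x ^+ 2) ^+ m * expR (- (c * x ^+ 2)) <= C.
Proof.
move=> c0; exists (m.+1`!%:R / c ^+ m.+1 * expR c); split.
  by rewrite mulr_ge0 ?expR_ge0// divr_ge0 ?exprn_ge0// ltW.
move=> x; have x1 : 1 <= 1 + x ^+ 2 by rewrite lerDl sqr_ge0.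
have y0 : 0 <= c * (1 + x ^+ 2) by rewrite mulr_ge0; lra.
rewrite expRN ler_pdivrMr ?expR_gt0// -[leRHS]mulrA -expRD.
have -> : c + c * x ^+ 2 = c * (1 + x ^+ 2) by ring.
have h := expR_ge1Dxn m y0.
rewrite mulrAC ler_pdivlMr ?exprn_gt0//.
rewrite mulrC [leRHS]mulrC -ler_pdivrMr ?ltr0n ?fact_gt0//.
have {}h : (c * (1 + x ^+ 2)) ^+ m.+1 / m.+1`!%:R <= expR (c * (1 + x ^+ 2)).
  by apply: le_trans h; rewrite lerDr.
apply: le_trans h.
rewrite exprMn ler_wpM2r ?invr_ge0// ler_wpM2l ?exprn_ge0 ?(ltW c0)//.
by rewrite [_ ^+ m.+1]exprS ler_peMl// exprn_ge0 ?(le_trans ler01).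
Qed.

(** The weight 1 / (1 + x^2) is integrable, with the arctangent as a primitive; it is
the only weight used to sum pointwise bounds over the grid. *)
Lemma poly_gauss_bounded (p : {poly R}) (c : R) : 0 < c -> exists C, 0 <= C /\
  forall x, `|p.[x]| * expR (- (c * x ^+ 2)) <= C / (1 + x ^+ 2).
Proof.
move=> c0; have [K [m [K0 hK]]] := poly_growth p.
have [C [C0 hC]] := pow_expR_bounded m.+1 c0.
exists (K * C); split; first exact: mulr_ge0.
move=> x; have x1 : 0 < 1 + x ^+ 2 by rewrite ltr_pwDl ?sqr_ge0.
rewrite ler_pdivlMr//; apply: le_trans (ler_wpM2l K0 (hC x)).
have h := ler_wpM2r (ltW x1) (ler_wpM2r (expR_ge0 (- (c * x ^+ 2))) (hK x)).
apply: le_trans h _; rewrite [_ ^+ m.+1]exprSr le_eqVlt; apply/orP; left; apply/eqP.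
by move: ((1 + x ^+ 2) ^+ m) (1 + _) => u v; ring.
Qed.
End Calculus.

(** * Domination of sequences, and the midpoint rule on the grid *)

Section Domination.
Variable R : realType.
Implicit Types (g u v : nat -> R).

(** The big-O relation for real sequences in a form that exposes the constant and
the rank. *)
Definition dominated g u := exists C N0, 0 <= C /\
  forall N, (N0 <= N)%N -> `|u N| <= C * g N.

Lemma dominated_near g u v : (exists N0, forall N, (N0 <= N)%N -> u N = v N) ->
  dominated g u -> dominated g v.
Proof.
move=> [N1 e] [C [N0 [C0 h]]]; exists C, (maxn N0 N1); split=> // N.
by rewrite geq_max => /andP[hN0 hN1]; rewrite -e// h.
Qed.

Lemma dominated_add g u v : dominated g u -> dominated g v ->
  dominated g (fun N => u N + v N).
Proof.
move=> [C [N0 [C0 h]]] [D [N1 [D0 k]]]; exists (C + D), (maxn N0 N1).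
split; first exact: addr_ge0.
move=> N; rewrite geq_max => /andP[hN0 hN1].
by rewrite mulrDl; apply: le_trans (ler_normD _ _) _; rewrite lerD ?h ?k.
Qed.

Lemma dominated_opp g u : dominated g u -> dominated g (fun N => - u N).
Proof. by move=> [C [N0 [C0 h]]]; exists C, N0; split=> // N; rewrite normrN; exact: h. Qed.

Lemma dominated_sub g u v : dominated g u -> dominated g v ->
  dominated g (fun N => u N - v N).
Proof. by move=> hu hv; apply: dominated_add => //; exact: dominated_opp. Qed.

Lemma dominated_mul g g' u v : dominated g u -> dominated g' v ->
  dominated (fun N => g N * g' N) (fun N => u N * v N).
Proof.
move=> [C [N0 [C0 h]]] [D [N1 [D0 k]]]; exists (C * D), (maxn N0 N1).
split; first exact: mulr_ge0.
move=> N; rewrite geq_max => /andP[hN0 hN1].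
by rewrite mulrACA normrM ler_pM ?h ?k.
Qed.

Lemma dominated_scale g u (c : R) : dominated g u -> dominated g (fun N => c * u N).
Proof.
move=> [C [N0 [C0 h]]]; exists (`|c| * C), N0; split=> [|N hN].
  exact: mulr_ge0.
by rewrite normrM -mulrA ler_wpM2l// h.
Qed.

Lemma dominated_sum g (I : finType) (P : pred I) (F : I -> nat -> R) :
  (forall N, 0 <= g N) -> (forall i, P i -> dominated g (F i)) ->
  dominated g (fun N => \sum_(i | P i) F i N).
Proof.
move=> g0 hF; move: (index_enum I) => s; elim: s => [|i s IH].
  exists 0, 0%N; split=> // N _; rewrite big_nil normr0 mul0r//.
have := IH; case Pi: (P i).
  move/(dominated_add (hF i Pi)); apply: dominated_near; exists 0%N => N _.
  by rewrite big_cons Pi.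
by apply: dominated_near; exists 0%N => N _; rewrite big_cons Pi.
Qed.

Lemma dominated_le g u v : dominated g v ->
  (exists N0, forall N, (N0 <= N)%N -> `|u N| <= v N) -> dominated g u.
Proof.
move=> [C [N0 [C0 h]]] [N1 k]; exists C, (maxn N0 N1); split=> // N.
rewrite geq_max => /andP[h0 h1]; apply: le_trans (k N h1) _.
by apply: le_trans (h N h0); rewrite ler_norm.
Qed.

Lemma dominated_mull g u v : dominated g u -> dominated (fun=> 1) v ->
  dominated g (fun N => u N * v N).
Proof.
move=> hu hv; have [C [N0 [C0 h]]] := dominated_mul hu hv.
by exists C, N0; split=> // N /h; rewrite mulr1.
Qed.

Lemma dominated_mulr g u v : dominated (fun=> 1) u -> dominated g v ->
  dominated g (fun N => u N * v N).
Proof.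
move=> hu hv; apply: dominated_near (dominated_mull hv hu).
by exists 0%N => N _; rewrite mulrC.
Qed.

Lemma dominated_const (c : R) : dominated (fun=> 1) (fun=> c).
Proof. by exists `|c|, 0%N; split=> // N _; rewrite mulr1. Qed.

Lemma dominated_abs g u : dominated g u -> dominated g (fun N => `|u N|).
Proof. by move=> [C [N0 [C0 h]]]; exists C, N0; split=> // N /h; rewrite normr_id. Qed.

End Domination.

Section Grid.
Variable R : realType.
Implicit Types (p q : {poly R}) (N : nat).

Local Notation om := (omega R).

(** The mesh of the grid on which the Hermite functions are sampled. *)
Definition step N : R := Num.sqrt (om N).
Definition node N (j : 'I_N) : R := step N * (lab j)%:~R.

Lemma om_ge0 N : 0 <= om N.
Proof. by rewrite /omega divr_ge0 ?mulr_ge0 ?pi_ge0. Qed.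

Lemma om_gt0 N : (0 < N)%N -> 0 < om N.
Proof. by move=> N0; rewrite /omega divr_gt0 ?mulr_gt0 ?pi_gt0 ?ltr0n. Qed.

Lemma step_ge0 N : 0 <= step N. Proof. exact: sqrtr_ge0. Qed.

Lemma step_sqr N : step N ^+ 2 = om N. Proof. by rewrite sqr_sqrtr ?om_ge0. Qed.

Lemma om_natM N : (0 < N)%N -> om N * N%:R = 2 * pi.
Proof. by move=> N0; rewrite /omega divfK// pnatr_eq0 -lt0n. Qed.

Lemma om_lt4 N : (2 <= N)%N -> om N < 4.
Proof.
move=> N2; rewrite /omega ltr_pdivrMr ?ltr0n ?(ltn_trans _ N2)//.
have : 2 <= N%:R :> R by rewrite (ler_nat _ 2).
have := @pi_lt4 R; nra.
Qed.

Lemma step_half_le1 N : (2 <= N)%N -> step N / 2 <= 1.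
Proof.
move=> N2; rewrite ler_pdivrMr// mul1r -(@ler_pXn2r _ 2) ?nnegrE ?step_ge0//.
by rewrite step_sqr; have := om_lt4 N2; lra.
Qed.

(** Moving by at most 1 changes the weight 1 + x^2 by a bounded factor, so that an
estimate at some point of a cell can be restated at its centre. *)
Lemma weight_shift (x y : R) : x - 1 <= y <= x + 1 ->
  1 + x ^+ 2 <= 3 * (1 + y ^+ 2).
Proof.
case/andP=> y1 y2; have h : (x - y) ^+ 2 <= 1.
  by have := @mulr_ge0 _ (y - x + 1) (x + 1 - y); nra.
by have := sqr_ge0 (x - 2 * y); nra.
Qed.

(** Endpoints of the cells of length step N centred at the nodes; they make sums over
all nodes telescope. *)
Definition cell_bound N (i : nat) : R := step N * (i%:R - (uphalf N)%:R + 2^-1).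

Lemma sum_cells N (F : R -> R) :
  \sum_(j < N) (F (node j + step N / 2) - F (node j - step N / 2)) =
  F (cell_bound N N) - F (cell_bound N 0).
Proof.
rewrite -(telescope_sumr (fun i => F (cell_bound N i)))// big_mkord.
apply: eq_bigr => j _; rewrite /node /cell_bound /lab rmorphD rmorphB /=.
by congr (F _ - F _); rewrite -?natr1; field.
Qed.

(** The grid covers an interval of length of order 1 / step N, which makes the
boundary terms of every telescoping sum O(omega). *)
Lemma cell_bound_large N i : (2 <= N)%N -> i = 0%N \/ i = N ->
  1 <= om N * cell_bound N i ^+ 2.
Proof.
move=> N2 hi; have N0 : (0 < N)%N by rewrite (ltn_trans _ N2).
have hN : 2 <= N%:R :> R by rewrite (ler_nat _ 2).
have hw := om_gt0 N0; have hpi := @pi_ge2 R.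
have e := om_natM N0.
have k : (4^-1 * N%:R) ^+ 2 <= (i%:R - (uphalf N)%:R + 2^-1 : R) ^+ 2.
  have h1 : N%:R <= 2 * (uphalf N)%:R :> R by rewrite -natrM ler_nat; lia.
  have h2 : 2 * (uphalf N)%:R <= N%:R + 1 :> R by rewrite -natrM natr1 ler_nat; lia.
  by case: hi => ->; nra.
rewrite /cell_bound exprMn step_sqr.
apply: (@le_trans _ _ (om N * (om N * (4^-1 * N%:R) ^+ 2))); last first.
  by do 2!(apply: ler_wpM2l; first exact: ltW).
have -> : om N * (om N * (4^-1 * N%:R) ^+ 2) = (om N * N%:R) ^+ 2 / 16 by field.
by rewrite e; nra.
Qed.

Lemma cell_bound_weight N i : (2 <= N)%N -> i = 0%N \/ i = N ->
  (1 + cell_bound N i ^+ 2)^-1 <= om N.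
Proof.
move=> N2 hi; have := cell_bound_large N2 hi; have := om_ge0 N => h0 h1.
rewrite -div1r ler_pdivrMr ?ltr_pwDl ?sqr_ge0//.
by rewrite mulrDr mulr1; lra.
Qed.

(** Each term is compared with the increment of the arctangent over the cell. *)
Lemma sum_inv_le N : (2 <= N)%N ->
  step N * (\sum_(j < N) (1 + node j ^+ 2)^-1) <= 12.
Proof.
move=> N2; have := sum_cells N (@atan R).
have h0 := step_ge0 N; have h1 := step_half_le1 N2.
move=> e; apply: (@le_trans _ _ (3 * (atan (cell_bound N N) - atan (cell_bound N 0)))); last first.
  have := atan_ltpi2 (cell_bound N N); have := atan_gtNpi2 (cell_bound N 0).
  by have := @pi_lt4 R; lra.
rewrite -e !mulr_sumr ler_sum// => j _; set x := node j.
have := @mean_value R (@atan R) (fun x => (1 + x ^+ 2)^-1) (x - step N / 2) (x + step N / 2).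
case=> [|c /andP[c1 c2] ->]; first lra.
have -> : x + step N / 2 - (x - step N / 2) = step N by field.
rewrite mulrA mulrC ler_wpM2r//.
have p1 : 0 < 1 + x ^+ 2 by rewrite ltr_pwDl ?sqr_ge0.
have p2 : 0 < 1 + c ^+ 2 by rewrite ltr_pwDl ?sqr_ge0.
rewrite ler_pdivlMr// mulrC ler_pdivrMr// weight_shift//; lra.
Qed.

(** Symmetric differences kill the even Taylor terms; three applications of the
mean value inequality leave a third derivative and the factor s^3. *)
Lemma midpoint_rule (F F1 F2 F3 : R -> R) (C x s : R) : 0 <= s <= 1 ->
  (forall x : R, is_derive x 1 F (F1 x)) -> (forall x : R, is_derive x 1 F1 (F2 x)) ->
  (forall x : R, is_derive x 1 F2 (F3 x)) ->
  (forall x, `|F3 x| <= C / (1 + x ^+ 2)) ->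
  `|F (x + s) - F (x - s) - 2 * s * F1 x| <= 6 * C / (1 + x ^+ 2) * s ^+ 3.
Proof.
case/andP=> s0 s1 d1 d2 d3 b3; set K := 3 * C / (1 + x ^+ 2).
have p1 (y : R) : 0 < 1 + y ^+ 2 by rewrite ltr_pwDl ?sqr_ge0.
have C0 : 0 <= C.
  by have := le_trans (normr_ge0 _) (b3 0); rewrite expr0n addr0 divr1.
have K0 : 0 <= K by rewrite /K divr_ge0 ?mulr_ge0// ltW.
have bK c : x - s <= c <= x + s -> `|F3 c| <= K.
  case/andP=> c1 c2; apply: le_trans (b3 c) _.
  rewrite /K [3 * C]mulrC -mulrA ler_wpM2l// ler_pdivlMr// mulrC ler_pdivrMr// weight_shift//; lra.
have dp (r : R) (G G1 : R -> R) : (forall x : R, is_derive x 1 G (G1 x)) ->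
    is_derive r 1 (fun y : R => G (x + y)) (G1 (x + r)).
  move=> dG; apply: (is_derive_eq (@is_derive_chain R G (fun y => x + y) r _ _ _ (dG _))).
  by ring.
have dm (r : R) (G G1 : R -> R) : (forall x : R, is_derive x 1 G (G1 x)) ->
    is_derive r 1 (fun y : R => G (x - y)) (- G1 (x - r)).
  move=> dG; apply: (is_derive_eq (@is_derive_chain R G (fun y => x - y) r _ _ _ (dG _))).
  by ring.
have k2 r : 0 <= r <= s -> `|F2 (x + r) - F2 (x - r)| <= 2 * K * s.
  case/andP=> r0 r1; have := @derive_bound R F2 F3 K (x - r) (x + r).
  have -> : x + r - (x - r) = 2 * r by ring.
  move=> h; apply: le_trans (h _ d3 _) _; first lra.
    by move=> c /andP[c1 c2]; apply: bK; lra.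
  by nra.
have k1 r : 0 <= r <= s -> `|F1 (x + r) + F1 (x - r) - 2 * F1 x| <= 2 * K * s * s.
  case/andP=> r0 r1.
  have := @derive_bound R (fun r => F1 (x + r) + F1 (x - r))
    (fun r => F2 (x + r) - F2 (x - r)) (2 * K * s) 0 r r0.
  rewrite addr0 !subr0 (_ : F1 x + F1 x = 2 * F1 x); last by ring.
  move=> h; apply: le_trans (h _ _) _.
  - by move=> c /andP[c1 c2]; apply: k2; lra.
  - by apply: ler_wpM2l => //; rewrite mulr_ge0// mulr_ge0.
have dd (y : R) : is_derive y 1 (fun r : R => F (x + r) - F (x - r) - 2 * F1 x * r)
    (F1 (x + y) + F1 (x - y) - 2 * F1 x).
  rewrite -[F1 (x - y)]opprK -[X in _ - X]mulr1.
  exact: (is_derive_sub (is_derive_sub (dp _ _ _ d1) (dm _ _ _ d1))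
            (is_derive_scale (2 * F1 x) (is_derive_id y (1 : R)))).
have := derive_bound s0 dd (K := 2 * K * s * s).
rewrite addr0 !subr0 subrr mulr0 !subr0 [2 * F1 x * s]mulrAC => h.
apply: le_trans (h _) _.
  by move=> c /andP[c1 c2]; apply: k1; lra.
by rewrite le_eqVlt; apply/orP; left; apply/eqP; rewrite /K; ring.
Qed.

(** The midpoint errors carry step N ^ 3, and summing them against the weight
restores one factor 1 / step N: this is the source of the rate omega. *)
Lemma riemann_sum (F F1 F2 F3 : R -> R) (C : R) N : (2 <= N)%N ->
  (forall x : R, is_derive x 1 F (F1 x)) -> (forall x : R, is_derive x 1 F1 (F2 x)) ->
  (forall x : R, is_derive x 1 F2 (F3 x)) ->
  (forall x, `|F3 x| <= C / (1 + x ^+ 2)) ->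
  `|step N * (\sum_(j < N) F1 (node j)) - (F (cell_bound N N) - F (cell_bound N 0))|
    <= 12 * C * om N.
Proof.
move=> N2 d1 d2 d3 b3; have h0 := step_ge0 N; have h1 := step_half_le1 N2.
have C0 : 0 <= C.
  by have := le_trans (normr_ge0 _) (b3 0); rewrite expr0n addr0 divr1.
rewrite -sum_cells mulr_sumr -sumrB; apply: le_trans (ler_norm_sum _ _ _) _.
apply: (@le_trans _ _ (C * om N * (step N * (\sum_(j < N) (1 + node j ^+ 2)^-1)))).
  rewrite mulrA mulr_sumr ler_sum// => j _.
  have /(_ _ d1 d2 d3 b3) := @midpoint_rule F F1 F2 F3 C (node j) (step N / 2).
  have -> : 2 * (step N / 2) = step N by field.
  rewrite distrC => h; apply: le_trans (h _) _; first lra.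
  rewrite -step_sqr.
  have k : 0 <= C / (1 + node j ^+ 2) * step N ^+ 3.
    by rewrite mulr_ge0 ?exprn_ge0// divr_ge0// addr_ge0// sqr_ge0.
  have -> : C * step N ^+ 2 * step N / (1 + node j ^+ 2) =
    C / (1 + node j ^+ 2) * step N ^+ 3 by ring.
  have -> : 6 * C / (1 + node j ^+ 2) * (step N / 2) ^+ 3 =
    C / (1 + node j ^+ 2) * step N ^+ 3 * (6 / 8) by field; rewrite gt_eqF// ltr_pwDl ?sqr_ge0.
  by lra.
rewrite [leRHS](_ : _ = C * om N * 12); last by ring.
by apply: ler_wpM2l (sum_inv_le N2); rewrite mulr_ge0 ?om_ge0.
Qed.

Lemma om_eventually_le (e : R) : 0 < e -> exists N0, forall N, (N0 <= N)%N -> om N <= e.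
Proof.
move=> e0; exists (Num.bound (8 / e)).+1 => N hN.
have N0 : 0 < N%:R :> R by rewrite ltr0n (leq_trans _ hN).
have h : 8 / e <= N%:R.
  have p : 0 <= 8 / e by rewrite divr_ge0// ltW.
  have := archi_boundP p; move=> /ltW /le_trans; apply.
  by rewrite ler_nat (leq_trans _ hN).
rewrite /omega ler_pdivrMr//; move: h; rewrite ler_pdivrMr// mulrC => h.
by have := @pi_lt4 R; lra.
Qed.

Lemma dominated_om_bounded (u : nat -> R) : dominated om u -> dominated (fun=> 1) u.
Proof.
move=> [C [N0 [C0 h]]]; have [N1 k] := om_eventually_le (@ltr01 R).
exists C, (maxn N0 N1); split=> // N; rewrite geq_max => /andP[h0 h1].
by apply: le_trans (h N h0) _; rewrite ler_wpM2l// k.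
Qed.

Lemma dominated_om_small (u : nat -> R) (e : R) : 0 < e -> dominated om u ->
  exists N0, forall N, (N0 <= N)%N -> `|u N| <= e.
Proof.
move=> e0 [C [N0 [C0 h]]].
have e1 : 0 < e / (C + 1) by rewrite divr_gt0// ltr_wpDl.
have [N1 k] := om_eventually_le e1.
exists (maxn N0 N1) => N; rewrite geq_max => /andP[h0 h1].
apply: le_trans (h N h0) _; apply: le_trans (ler_wpM2l C0 (k N h1)) _.
rewrite mulrCA ler_piMr ?(ltW e0)// ler_pdivrMr ?mul1r ?lerDl//.
by rewrite ltr_wpDl.
Qed.

End Grid.

(** * Gaussian sums and the Gram matrix of the sampled Hermite functions *)

Section GaussianPrimitive.
Variable R : realType.
Let mu := @lebesgue_measure R.

(** A primitive of exp (- x^2) that vanishes at 0. It is made from improper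
integrals because a differentiable function on the whole line is needed. *)
Definition gauss_primitive (x : R) : R :=
  \int[mu]_(t in `]-oo, x]) gauss_fun t - \int[mu]_(t in `]-oo, 0]) gauss_fun t.

Lemma is_derive_gauss_primitive (x : R) :
  is_derive x 1 gauss_primitive (expR (- x ^+ 2)).
Proof.
have [] := @continuous_FTC1 R gauss_fun (BInfty _ true) x (x + 1).
- by rewrite ltrDl.
- exact: (integrableS measurableT _ _ (integrableT_gauss)).
- by rewrite ltNyr.
- exact: continuous_gauss_fun.
move=> dF eF; rewrite -[expR _]subr0; apply: is_derive_sub.
by apply: DeriveDef; [exact: dF|rewrite -derive1E eF].
Qed.

(** Identifies the primitive on the half line with the function whose limit is the
Gaussian integral. *)
Lemma gauss_primitiveE (x : R) : 0 <= x ->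
  gauss_primitive x = gauss_integral_proof.integral0_gauss x.
Proof.
move=> x0; rewrite /gauss_primitive.
rewrite (@Rintegral_itvB R gauss_fun -oo%O (BRight x) 0)//.
  rewrite Rintegral_itv_obnd_cbnd//.
  exact: (integrableS measurableT _ _ (integrableT_gauss)).
exact: (integrableS measurableT _ _ (integrableT_gauss)).
Qed.

Lemma gauss_primitiveN (x : R) : gauss_primitive (- x) = - gauss_primitive x.
Proof.
wlog x0 : x / 0 <= x => [hw|].
  by have [/hw//|/ltW] := leP 0 x; rewrite -oppr_ge0 => /hw; rewrite opprK => ->; rewrite opprK.
have d (y : R) : is_derive y 1 (fun y : R => gauss_primitive y + gauss_primitive (- y)) 0.
  rewrite -(subrr (expR (- y ^+ 2))); apply: is_derive_add.
    exact: is_derive_gauss_primitive.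
  apply: (is_derive_eq (is_derive_chain (is_deriveNid y (1 : R)) (is_derive_gauss_primitive _))).
  by rewrite mulrN1 sqrrN.
have [c _] := mean_value x0 d.
rewrite oppr0 mul0r {3 4}/gauss_primitive subrr addr0 subr0 => /eqP.
by rewrite addrC addr_eq0 => /eqP.
Qed.

Lemma cvg_gauss_primitive : gauss_primitive x @[x --> +oo] --> Num.sqrt pi / 2.
Proof.
have cvg_Ig : gauss_integral_proof.integral0_gauss x @[x --> +oo] --> (Num.sqrt pi / 2 : R).
  have : Num.sqrt (@gauss_integral_proof.integral0_gauss R x ^+ 2) @[x --> +oo]
      --> Num.sqrt (pi / 4).
    apply: continuous_cvg => //;
      [exact: sqrt_continuous|exact: gauss_integral_proof.cvg_integral0_gauss_sqr].
  rewrite sqrtrM ?pi_ge0// sqrtrV// (_ : 4 = 2 ^+ 2); last by rewrite expr2 -natrM.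
  rewrite sqrtr_sqr ger0_norm//; apply: cvg_trans; apply: near_eq_cvg.
  near=> x; rewrite sqrtr_sqr ger0_norm//.
  exact: gauss_integral_proof.integral0_gauss_ge0.
apply: cvg_trans cvg_Ig; apply: near_eq_cvg.
by near=> x; rewrite gauss_primitiveE.
Unshelve. all: by end_near. Qed.

(** For x >= 1/2 the function - exp (- x^2) grows at least as fast as the primitive,
since 2 x >= 1. *)
Lemma gauss_primitive_tail (x : R) : 2^-1 <= x ->
  `|gauss_primitive x - Num.sqrt pi / 2| <= expR (- x ^+ 2).
Proof.
move=> x2; have c := cvg_gauss_primitive.
have cl := cvg_lim (@Rhausdorff R) c.
have cv : cvg (gauss_primitive y @[y --> +oo]) by apply/cvg_ex; exists (Num.sqrt pi / 2).
rewrite distrC ger0_norm ?subr_ge0; last first.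
  rewrite -cl; apply: limr_ge => //; near=> y.
  have xy : x <= y by near: y; apply: nbhs_pinfty_ge; rewrite num_real.
  exact: (derive_ge0_le xy is_derive_gauss_primitive (fun z _ => expR_ge0 _)).
rewrite lerBlDr addrC -cl; apply: limr_le => //; near=> y.
have xy : x <= y by near: y; apply: nbhs_pinfty_ge; rewrite num_real.
have := @derive_ge0_le _ (fun x => - expR (- x ^+ 2) - gauss_primitive x)
  (fun x => - - (2 * x * expR (- x ^+ 2)) - expR (- x ^+ 2)) x y xy.
have d (z : R) : is_derive z 1 (fun x => - expR (- x ^+ 2) - gauss_primitive x)
    (- - (2 * z * expR (- z ^+ 2)) - expR (- z ^+ 2)).
  apply: is_derive_sub; last exact: is_derive_gauss_primitive.
  by apply: is_deriveN; exact: is_derive_gauss.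
move=> /(_ d) h.
have : - expR (- x ^+ 2) - gauss_primitive x <= - expR (- y ^+ 2) - gauss_primitive y.
  apply: h => z /andP[xz _]; rewrite opprK.
  rewrite -[X in _ - X]mul1r -mulrBl mulr_ge0 ?expR_ge0//; lra.
by have := expR_ge0 (- y ^+ 2); lra.
Unshelve. all: by end_near. Qed.

End GaussianPrimitive.

Section HermitePolynomials.
Variable R : realType.
Implicit Types (p q : {poly R}) (N n : nat).
Local Notation om := (omega R).

Definition pgauss p (x : R) : R := p.[x] * expR (- x ^+ 2).

(** The action of differentiation on the polynomial factor of p exp (- x^2). *)
Definition gauss_deriv p : {poly R} := p^`() - ('X * p) *+ 2.

Lemma is_derive_pgauss p (x : R) :
  is_derive x 1 (pgauss p) (pgauss (gauss_deriv p) x).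
Proof.
apply: (is_derive_eq (is_derive_mul (is_derive_horner p x) (is_derive_gauss x))).
rewrite /pgauss /gauss_deriv hornerD hornerN hornerMn hornerM hornerX -mulr_natl.
by move: (expR _) => e; ring.
Qed.

Lemma pgauss_bound p : exists C, 0 <= C /\
  forall x : R, `|pgauss p x| <= C / (1 + x ^+ 2).
Proof.
have [C [C0 h]] := poly_gauss_bounded p (@ltr01 R); exists C; split=> // x.
by have := h x; rewrite mul1r /pgauss normrM (ger0_norm (expR_ge0 _)).
Qed.

Definition gauss_sum p N : R := step R N * \sum_(j < N) pgauss p (node R j).

Lemma gauss_sumD p q N : gauss_sum (p + q) N = gauss_sum p N + gauss_sum q N.
Proof.
rewrite /gauss_sum -mulrDr -big_split; congr (_ * _).
by apply: eq_bigr => j _; rewrite /pgauss hornerD mulrDl.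
Qed.

Lemma gauss_sumN p N : gauss_sum (- p) N = - gauss_sum p N.
Proof.
rewrite /gauss_sum -mulrN -sumrN; congr (_ * _).
by apply: eq_bigr => j _; rewrite /pgauss hornerN mulNr.
Qed.

Lemma gauss_sumC (c : R) N : gauss_sum c%:P N = c * gauss_sum 1 N.
Proof.
rewrite /gauss_sum mulrCA; congr (_ * _); rewrite mulr_sumr.
by apply: eq_bigr => j _; rewrite /pgauss !hornerC mul1r.
Qed.

(** Discrete Gaussian integration by parts: the midpoint rule replaces the sum of a
derivative by boundary values, and these are O(omega) by decay. *)
Lemma gauss_sum_deriv p : dominated om (gauss_sum (gauss_deriv p)).
Proof.
have [C [C0 hC]] := pgauss_bound (gauss_deriv (gauss_deriv (gauss_deriv p))).
have [D [D0 hD]] := pgauss_bound p.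
exists (12 * C + (D + D)), 2%N; split=> [|N N2]; first by rewrite !addr_ge0// mulr_ge0.
have := @riemann_sum R (pgauss p) _ _ _ C N N2 (is_derive_pgauss _) (is_derive_pgauss _)
  (is_derive_pgauss _) hC.
set S := step R N * _ => h.
have b i : i = 0%N \/ i = N -> `|pgauss p (cell_bound R N i)| <= D * om N.
  move=> hi; apply: le_trans (hD _) _; apply: ler_wpM2l => //.
  exact: cell_bound_weight.
have b0 := b 0%N (or_introl erefl); have bN := b N (or_intror erefl).
rewrite -/(gauss_sum _ N) in S h *.
rewrite -/S -[S](subrK (pgauss p (cell_bound R N N) - pgauss p (cell_bound R N 0))).
apply: le_trans (ler_normD _ _) _; rewrite mulrDl lerD//.
by apply: le_trans (ler_normB _ _) _; rewrite mulrDl lerD.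
Qed.

Lemma gauss_sum1 : dominated om (fun N => gauss_sum 1 N - Num.sqrt pi).
Proof.
have [C [C0 hC]] := pgauss_bound (gauss_deriv (gauss_deriv 1)).
have [D [D0 hD]] := pgauss_bound 1.
exists (12 * C + (D + D)), 2%N; split=> [|N N2]; first by rewrite !addr_ge0// mulr_ge0.
have d (x : R) : is_derive x 1 (@gauss_primitive R) (pgauss 1 x).
  by rewrite /pgauss hornerC mul1r; exact: is_derive_gauss_primitive.
have := @riemann_sum R _ _ _ _ C N N2 d (is_derive_pgauss _) (is_derive_pgauss _) hC.
rewrite -/(gauss_sum 1 N) => h.
have b i : i = 0%N \/ i = N -> `|pgauss 1 (cell_bound R N i)| <= D * om N.
  move=> hi; apply: le_trans (hD _) _; apply: ler_wpM2l => //.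
  exact: cell_bound_weight.
have half i : i = 0%N \/ i = N -> 2^-1 <= `|cell_bound R N i|.
  move=> hi; have := cell_bound_large R N2 hi; have := om_lt4 R N2.
  rewrite -real_normK ?num_real// => h1 h2.
  have h3 := normr_ge0 (cell_bound R N i); rewrite leNgt; apply/negP => h4.
  have h5 : `|cell_bound R N i| ^+ 2 <= 4^-1 by nra.
  have := om_ge0 R N; nra.
have tN : `|gauss_primitive (cell_bound R N N) - Num.sqrt pi / 2| <= D * om N.
  apply: le_trans (b _ (or_intror erefl)).
  rewrite /pgauss hornerC mul1r (ger0_norm (expR_ge0 _)).
  apply: gauss_primitive_tail; apply: le_trans (half _ (or_intror erefl)) _.
  rewrite ger0_norm// /cell_bound mulr_ge0 ?step_ge0// addr_ge0// subr_ge0 ler_nat.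
  lia.
have t0 : `|- gauss_primitive (cell_bound R N 0) - Num.sqrt pi / 2| <= D * om N.
  rewrite -gauss_primitiveN; apply: le_trans (b _ (or_introl erefl)).
  rewrite /pgauss hornerC mul1r (ger0_norm (expR_ge0 _)) -sqrrN.
  apply: gauss_primitive_tail; apply: le_trans (half _ (or_introl erefl)) _.
  rewrite ler0_norm// /cell_bound mulr_ge0_le0 ?step_ge0//.
  have : 1 <= (uphalf N)%:R :> R by rewrite (ler_nat _ 1); lia.
  lra.
move: h tN t0; rewrite !mulrDl !ler_norml; lra.
Qed.

(** The Rodrigues recurrence for the Hermite polynomials: each step is minus the
differentiation of p exp (- x^2). *)
Fixpoint hermp n : {poly R} :=
  if n is m.+1 then - gauss_deriv (hermp m) else 1.

Lemma size_hermp n : (size (hermp n) <= n.+1)%N.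
Proof.
elim: n => [|n IH]; first by rewrite size_poly1.
rewrite /= size_polyN; apply: leq_trans (size_polyD _ _) _; rewrite size_polyN.
rewrite geq_max; apply/andP; split.
  by apply: leq_trans (size_poly _ _) _; lia.
rewrite mulr2n; apply: leq_trans (size_polyD _ _) _; rewrite maxnn.
by apply: leq_trans (size_polyMleq _ _) _; rewrite size_polyX; exact: IH.
Qed.

Lemma lead_hermp n : (hermp n)`_n = 2 ^+ n.
Proof.
elim: n => [|n IH]; first by rewrite coefC.
rewrite /= /gauss_deriv coefN coefB coefMn coefXM /= IH coef_deriv.
rewrite (nth_default 0 (leqW (size_hermp n))) mul0rn sub0r opprK exprS.
by rewrite mulr_natl.
Qed.

(** Integration by parts n times moves the derivatives from the Gaussian to q. *)
Lemma gauss_sum_hermpM n q :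
  dominated om (fun N => gauss_sum (hermp n * q) N - gauss_sum q^`(n) N).
Proof.
elim: n q => [|n IH] q.
  exists 0, 0%N; split=> // N _.
  by rewrite derivn0 mul1r subrr normr0 mul0r.
have := dominated_sub (IH q^`()) (gauss_sum_deriv (hermp n * q)).
apply: dominated_near; exists 0%N => N _.
rewrite derivSn addrAC; congr (_ - _); rewrite -gauss_sumN -gauss_sumD.
congr gauss_sum; rewrite /= /gauss_deriv derivM mulNr mulrBl; ring.
Qed.

Lemma derivn_hermp n : (hermp n)^`(n) = (2 ^+ n * n`!%:R)%:P.
Proof.
apply/polyP => i; rewrite coef_derivn coefC; case: i => [|i] /=.
  by rewrite addn0 lead_hermp ffactnn mulr_natr.
by rewrite nth_default ?mul0rn//; apply: leq_trans (size_hermp n) _; lia.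
Qed.

(** With m >= n, the m-th derivative of the second factor is constant, and zero unless
m = n. *)
Lemma gauss_sum_hermp m n :
  dominated om (fun N => gauss_sum (hermp m * hermp n) N -
    (m == n)%:R * (Num.sqrt pi * 2 ^+ n * n`!%:R)).
Proof.
wlog mn : m n / (n <= m)%N => [hw|].
  have [/hw//|/ltnW/hw] := leqP n m.
  rewrite mulrC eq_sym; case: eqP => [->//|_]; rewrite !mul0r//.
have [<-|ne] := eqVneq m n.
  have := dominated_add (gauss_sum_hermpM m (hermp m))
    (dominated_scale (2 ^+ m * m`!%:R) gauss_sum1).
  apply: dominated_near; exists 0%N => N _.
  rewrite derivn_hermp gauss_sumC mul1r.
  by move: (gauss_sum 1 N) (gauss_sum _ N) (Num.sqrt _) (2 ^+ m) (m`!%:R) => a b c d e; ring.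
have := gauss_sum_hermpM m (hermp n); apply: dominated_near; exists 0%N => N _.
rewrite derivn_poly0 ?mul0r; last by apply: leq_trans (size_hermp n) _; lia.
by rewrite -polyC0 gauss_sumC mul0r.
Qed.

(** The normalising constant of the Hermite function. *)
Definition kappa n : R := (Num.sqrt (Num.sqrt pi * 2 ^+ n * n`!%:R))^-1.

Lemma kappa_gt0 n : 0 < kappa n.
Proof.
rewrite invr_gt0 sqrtr_gt0 mulr_gt0 ?ltr0n ?fact_gt0//.
by rewrite mulr_gt0 ?exprn_gt0 ?sqrtr_gt0 ?pi_gt0.
Qed.

Lemma kappa_sqr n : kappa n ^+ 2 * (Num.sqrt pi * 2 ^+ n * n`!%:R) = 1.
Proof.
have h : 0 < Num.sqrt pi * 2 ^+ n * n`!%:R :> R.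
  by rewrite !mulr_gt0 ?exprn_gt0 ?sqrtr_gt0 ?pi_gt0 ?ltr0n ?fact_gt0.
by rewrite /kappa exprVn sqr_sqrtr ?ltW// mulVf// gt_eqF.
Qed.

Lemma derive1n_gauss n (x : R) :
  derive1n n (fun y : R => expR (- y ^+ 2)) x = (-1) ^+ n * pgauss (hermp n) x.
Proof.
elim: n x => [|n IH] x; first by rewrite /pgauss hornerC !mul1r.
have -> : derive1n n.+1 (fun y : R => expR (- y ^+ 2)) x =
    derive1 (fun x => (-1) ^+ n * pgauss (hermp n) x) x.
  by rewrite -[LHS]/(derive1 _ x); congr derive1; apply/funext.
rewrite derive1E.
have h := is_derive_scale ((-1) ^+ n) (is_derive_pgauss (hermp n) x).
rewrite derive_val exprS /pgauss hornerN; ring.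
Qed.

Lemma hermiteE n (x : R) :
  hermite n x = kappa n * (hermp n).[x] * expR (- (x ^+ 2 / 2)).
Proof.
rewrite /hermite derive1n_gauss /pgauss -/(kappa n).
have -> : expR (- (x ^+ 2 / 2)) = expR (x ^+ 2 / 2) * expR (- x ^+ 2).
  by rewrite -expRD; congr expR; field.
rewrite (_ : _ * (_ * (_ * _)) = ((-1) ^+ n * (-1) ^+ n) *
  (kappa n * (hermp n).[x] * (expR (x ^+ 2 / 2) * expR (- x ^+ 2)))); last by ring.
by rewrite -exprD addnn -mul2n exprM sqrrN expr1n expr1n mul1r.
Qed.

Lemma om_root4 N : omega R N `^ 4^-1 * omega R N `^ 4^-1 = step R N.
Proof.
rewrite /step -powR12_sqrt ?om_ge0// -powRD; first by congr (_ `^ _); field.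
by apply/implyP => /eqP; lra.
Qed.

Lemma dot_Psi m n : dominated om
  (fun N => dot (Psi R N m) (Psi R N n) - (m == n)%:R).
Proof.
have [C [N0 [C0 h]]] := gauss_sum_hermp m n.
exists (kappa m * kappa n * C), N0; split=> [|N /h hN].
  by rewrite mulr_ge0// mulr_ge0// ltW// kappa_gt0.
have -> : dot (Psi R N m) (Psi R N n) - (m == n)%:R = kappa m * kappa n *
  (gauss_sum (hermp m * hermp n) N - (m == n)%:R * (Num.sqrt pi * 2 ^+ n * n`!%:R)).
  rewrite mulrBr; congr (_ - _); last first.
    case: eqP => [->|_]; last by rewrite mul0r mulr0.
    by rewrite mul1r -expr2 kappa_sqr.
  rewrite /dot /gauss_sum -om_root4 mulrA mulr_sumr; apply: eq_bigr => j _.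
  rewrite !mxE !hermiteE /pgauss hornerM -/(node R j).
  have -> : expR (- node R j ^+ 2) =
      expR (- (node R j ^+ 2 / 2)) * expR (- (node R j ^+ 2 / 2)).
    by rewrite -expRD; congr expR; field.
  by move: (omega R N `^ _) (expR _) => a b; ring.
have k0 : 0 <= kappa m * kappa n by rewrite mulr_ge0// ltW// kappa_gt0.
by rewrite normrM (ger0_norm k0) -[leRHS]mulrA ler_wpM2l.
Qed.

End HermitePolynomials.

(** * The window and its Gaussian approximation *)

Section Window.
Variable R : realType.
Local Notation om := (omega R).

(** The bookkeeping between the two cut-offs: w is close to N/4, m is close to N/2
with m <= N/2, and N is large enough for the defects to be negligible. The
constant c absorbs the dependence on the index of the basis vector. *)
Definition balanced (c N w m : nat) : Prop :=
  [/\ (100 * c.+1 <= N)%N, (N <= 4 * w + c)%N, (4 * w <= N + c)%N,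
      (N <= 2 * m + 2)%N & (2 * m <= N)%N].

(** The angle of the half argument: cos (omega x) = 1 - 2 sin^2 (half_om N * x). *)
Definition half_om (N : nat) : R := pi / N%:R.

Lemma omE N : om N = 2 * half_om N.
Proof. by rewrite /omega /half_om mulrA. Qed.

Definition halfsin (N : nat) (x : R) : R := sin (half_om N * x).

(** An eigenvector of small width vanishes at the labels j with w < |j| <= m. This is
the polynomial in cos (omega x) with exactly these zeros, normalised to the value 1
at x = 0. *)
Definition window (N w m : nat) (x : R) : R :=
  \prod_(w.+1 <= j < m.+1) (1 - (halfsin N x / halfsin N j%:R) ^+ 2).

Definition cot (x : R) := cos x / sin x.

Lemma cot_sub (x y : R) : sin x != 0 -> sin y != 0 ->
  cot x - cot y = sin (y - x) / (sin x * sin y).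
Proof. by move=> hx hy; rewrite sinB /cot; field; rewrite hx hy. Qed.

Section BalancedReal.
Variables (c N w m : nat).
Hypothesis bal : balanced c N w m.

Lemma balanced_large : 100 * (c%:R + 1) <= N%:R :> R.
Proof. by case: bal => h _ _ _ _; rewrite natr1 -natrM ler_nat. Qed.

Lemma balanced_w_ge : N%:R <= 4 * w%:R + c%:R :> R.
Proof. by case: bal => _ h _ _ _; rewrite -natrM -natrD ler_nat. Qed.

Lemma balanced_w_le : 4 * w%:R <= N%:R + c%:R :> R.
Proof. by case: bal => _ _ h _ _; rewrite -natrM -natrD ler_nat. Qed.

Lemma balanced_m_ge : N%:R <= 2 * m%:R + 2 :> R.
Proof. by case: bal => _ _ _ h _; rewrite -natrM -natrD ler_nat. Qed.

Lemma balanced_m_le : 2 * m%:R <= N%:R :> R.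
Proof. by case: bal => _ _ _ _ h; rewrite -natrM ler_nat. Qed.

Lemma balanced_pos : (0 < N)%N.
Proof. by case: bal => h _ _ _ _; apply: leq_trans h; rewrite muln_gt0. Qed.

Lemma balanced_gt0 : 0 < N%:R :> R.
Proof. by rewrite ltr0n balanced_pos. Qed.

Lemma balanced_angle_gt0 : 0 < half_om N.
Proof. by rewrite /half_om divr_gt0 ?pi_gt0 ?balanced_gt0. Qed.

Lemma balanced_angleM : half_om N * N%:R = pi.
Proof. by rewrite /half_om divfK// gt_eqF ?balanced_gt0. Qed.

Lemma balanced_real :
  [/\ [/\ 100 * (c%:R + 1) <= N%:R :> R, N%:R <= 4 * w%:R + c%:R :> R,
        4 * w%:R <= N%:R + c%:R :> R, N%:R <= 2 * m%:R + 2 :> R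
      & 2 * m%:R <= N%:R :> R],
      [/\ 0 <= c%:R :> R, 0 < N%:R :> R, 0 < half_om N
      & half_om N * N%:R = pi]
    & 2 <= pi :> R /\ pi < 4 :> R].
Proof.
split; split; rewrite ?pi_ge2 ?pi_lt4 ?balanced_angleM//.
- exact: balanced_large.
- exact: balanced_w_ge.
- exact: balanced_w_le.
- exact: balanced_m_ge.
- exact: balanced_m_le.
- exact: balanced_gt0.
- exact: balanced_angle_gt0.
Qed.

End BalancedReal.

Section Estimates.
Variables (c N w m : nat).
Hypothesis bal : balanced c N w m.

Local Notation d := (half_om N).
Local Notation s := (halfsin N).
Local Notation A := (\sum_(w.+1 <= j < m.+1) (s j%:R ^+ 2)^-1).

Lemma balanced_lt : (w < m)%N.
Proof. by case: bal; lia. Qed.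

(* The numeric content of the balance hypothesis, for linear arithmetic. *)
Local Ltac facts :=
  have wm := balanced_lt;
  have [[Nr_ge w_ge w_le m_ge m_le] [c_ge0 Nr_gt0 d_gt0 dN] [pi2 pi4]] := balanced_real bal.

Lemma angle_le (x : R) : 2 * x <= N%:R -> d * x <= pi / 2.
Proof.
facts.
by move=> h; rewrite -dN -mulrA ler_pM2l//; lra.
Qed.

(** As c <= N / 100 and pi >= 2, the angle is at least 2 * 99 / 400; the smaller
value 3/7 is convenient because a third of it is 1/7. *)
Lemma angle_ge (x : R) : N%:R <= 4 * x + c%:R -> 3 / 7 <= d * x.
Proof.
facts.
move=> h; have h2 : 0 <= d * (x - 99 / 400 * N%:R).
  by apply: mulr_ge0; [exact: ltW|clear -h Nr_ge c_ge0; lra].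
rewrite mulrBr mulrCA dN in h2; clear -h2 pi2; lra.
Qed.

(** The bound x / 3 <= sin x turns the lower bound for the angle into one for the
denominators of the window. *)
Lemma halfsin_ge (j : R) : w%:R <= j -> 2 * j <= N%:R -> 7^-1 <= s j.
Proof.
facts.
move=> wj jN; have a1 := angle_le jN.
have a2 : 3 / 7 <= d * j by apply: angle_ge; lra.
apply: le_trans (sin_ge_third _); first by lra.
by apply/andP; split; lra.
Qed.

Lemma halfsin_mono (x y : R) : `|x| <= y -> 2 * y <= N%:R -> `|s x| <= s y.
Proof.
facts.
wlog x0 : x / 0 <= x => [hw|].
  have [/hw//|/ltW] := leP 0 x; rewrite -oppr_ge0 => /hw.
  by rewrite normrN /halfsin mulrN sinN normrN.
rewrite (ger0_norm x0) => xy yN; have ay := angle_le yN.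
have ax0 : 0 <= d * x by rewrite mulr_ge0// ltW.
have axy : d * x <= d * y by rewrite ler_wpM2l// ltW.
rewrite ger0_norm; last by apply: sin_ge0_pi; apply/andP; split; lra.
rewrite /halfsin; move: axy; rewrite le_eqVlt => /orP[/eqP->//|axy].
by apply: ltW; rewrite ltr_sin// in_itv /=; apply/andP; split; lra.
Qed.

Lemma inv_halfsin_le (j : R) : w%:R <= j -> 2 * j <= N%:R -> (s j ^+ 2)^-1 <= 49.
Proof.
facts.
move=> wj jN; have h := halfsin_ge wj jN.
have p : 0 < s j ^+ 2 by rewrite exprn_gt0//; lra.
rewrite -[leRHS]invrK lef_pV2 ?posrE ?invr_gt0//; nra.
Qed.

Lemma inv_halfsin_ge1 (j : R) : w%:R <= j -> 2 * j <= N%:R -> 1 <= (s j ^+ 2)^-1.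
Proof.
facts.
move=> wj jN; have h := halfsin_ge wj jN.
have p : 0 < s j ^+ 2 by rewrite exprn_gt0//; lra.
rewrite -[leLHS]invrK lef_pV2 ?posrE ?invr1//.
by have := @sin_le1 R (d * j); rewrite -/(s j); nra.
Qed.

Lemma window_range j : (w.+1 <= j < m.+1)%N -> w%:R <= j%:R :> R /\ 2 * j%:R <= N%:R :> R.
Proof.
facts.
case/andP=> h1 h2; split; first by rewrite ler_nat ltnW.
by apply: le_trans m_le; rewrite -!natrM ler_nat leq_mul2l.
Qed.

Lemma sum_window_const (C : R) : \sum_(w.+1 <= j < m.+1) C = C * (m%:R - w%:R).
Proof.
facts.
by rewrite big_const_nat subSS iter_addr_0 -[C *+ _]mulr_natr natrB// ltnW.
Qed.

Lemma sum_inv_halfsin_le : A <= 49 * N%:R.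
Proof.
facts.
apply: (@le_trans _ _ (\sum_(w.+1 <= j < m.+1) 49)).
  by rewrite !big_nat; apply: ler_sum => j /window_range[h1 h2]; exact: inv_halfsin_le.
by rewrite sum_window_const; have := ler0n R w; nra.
Qed.

Lemma sum_inv_halfsin_ge : N%:R / 5 <= A.
Proof.
facts.
apply: (@le_trans _ _ (\sum_(w.+1 <= j < m.+1) 1)).
  by rewrite sum_window_const; lra.
by rewrite !big_nat; apply: ler_sum => j /window_range[h1 h2]; exact: inv_halfsin_ge1.
Qed.

(** At labels close to N/4 the angle is within O(1/N) of pi/4, where cot = 1. *)
Lemma cot_near1 (x : R) : w%:R <= x -> 2 * x <= N%:R -> 4 * x <= N%:R + c%:R + 4 ->
  `|cot (d * x) - 1| <= 14 * (c%:R + 4) / N%:R.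
Proof.
facts.
move=> wx xN x4; have h := halfsin_ge wx xN.
have sx0 : 0 < s x by lra.
have q : cos (pi / 4) = sin (pi / 4) :> R.
  by rewrite -cosBpihalf -cosN; congr cos; field.
have -> : cot (d * x) - 1 = ((cos (d * x) - cos (pi / 4)) - (sin (d * x) - sin (pi / 4))) / s x.
  by rewrite q /cot -/(s x); field; rewrite gt_eqF.
have e : `|d * x - pi / 4| <= (c%:R + 4) / N%:R.
  have -> : d * x - pi / 4 = d * (x - N%:R / 4) by rewrite -dN; ring.
  rewrite normrM gtr0_norm// mulrAC ler_pM2r ?invr_gt0//.
  have : `|x - N%:R / 4| <= (c%:R + 4) / 4 by rewrite ler_norml; lra.
  by have := normr_ge0 (x - N%:R / 4); nra.
have e0 := normr_ge0 (d * x - pi / 4).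
rewrite normrM normfV (gtr0_norm sx0) ler_pdivrMr//.
apply: le_trans (ler_normB _ _) _.
have := lip_cos (pi / 4) (d * x); have := lip_sin (pi / 4) (d * x).
rewrite -[14 * _ / _]mulrA; move: ((c%:R + 4) / N%:R) e => u e; nra.
Qed.

(** At labels close to N/2 the angle is within O(1/N) of pi/2, where cot = 0. *)
Lemma cot_end : 0 <= cot (d * m%:R) <= 28 / N%:R.
Proof.
facts.
have [h1 h2] : w%:R <= m%:R :> R /\ 2 * m%:R <= N%:R :> R.
  by split; [rewrite ler_nat ltnW|exact: m_le].
have h := halfsin_ge h1 h2; have am := angle_le h2.
have sx0 : 0 < s m%:R by lra.
have a0 : 0 <= d * m%:R by rewrite mulr_ge0// ltW.
have c0 : 0 <= cos (d * m%:R) by apply: cos_ge0_pihalf; apply/andP; split; lra.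
have -> /= : 0 <= cot (d * m%:R) by rewrite divr_ge0// ltW.
rewrite /cot ler_pdivrMr//.
have := lip_cos (pi / 2) (d * m%:R); rewrite cos_pihalf subr0 (ger0_norm c0) => k.
apply: (@le_trans _ _ (4 / N%:R)).
  apply: le_trans k _; rewrite ler_norml; apply/andP; split; last first.
    by rewrite (@le_trans _ _ 0) ?divr_ge0// subr_le0.
  have -> : d * m%:R - pi / 2 = d * (m%:R - N%:R / 2) by rewrite -dN; ring.
  have : d * (- 1) <= d * (m%:R - N%:R / 2) by rewrite ler_pM2l//; lra.
  have : d <= 4 / N%:R by rewrite ler_pdivlMr// dN ltW.
  by lra.
have : 0 < N%:R^-1 :> R by rewrite invr_gt0.
rewrite -/(s _); nra.
Qed.

(** The difference cot (d j) - cot (d (j + 1)) equals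
sin d / (sin (d j) sin (d (j + 1))), and the denominator lies between the squares
of the two sines. So sin d times the sum is trapped between two telescoping sums,
both of which are close to cot (pi/4) - cot (pi/2) = 1. *)
Lemma sum_inv_halfsin_approx : `|d * A - 1| <= (14 * c%:R + 40 * 100) / N%:R.
Proof.
facts.
have iN : 0 < N%:R^-1 :> R by rewrite invr_gt0.
have sd0 : 0 <= sin d.
  by apply: sin_ge0_pi; rewrite ltW//=; nra.
have pos (j : R) : w%:R <= j -> 2 * j <= N%:R -> 0 < s j.
  by move=> h1 h2; have := halfsin_ge h1 h2; lra.
have dS (j : nat) : d * j.+1%:R - d * j%:R = d by rewrite -natr1; ring.
have up : sin d * A <= cot (d * w%:R) - cot (d * m%:R).
  have -> : cot (d * w%:R) - cot (d * m%:R) =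
      \sum_(w.+1 <= j < m.+1) (cot (d * j.-1%:R) - cot (d * j%:R)).
    rewrite big_add1 /= -opprB -(telescope_sumr (fun j => cot (d * j%:R))) ?(ltnW wm)//.
    by rewrite -sumrN; apply: eq_bigr => j _; rewrite opprB.
  rewrite mulr_sumr !big_nat; apply: ler_sum => j jr.
  have [h1 h2] := window_range jr; case/andP: jr => j1 j2.
  case: j j1 j2 h1 h2 => // j j1 j2 h1 h2 /=.
  have h3 : w%:R <= j%:R :> R by rewrite ler_nat.
  have h4 : 2 * j%:R <= N%:R :> R by apply: le_trans h2; rewrite -natr1; lra.
  have p1 := pos _ h1 h2; have p2 := pos _ h3 h4.
  rewrite cot_sub ?gt_eqF// dS ler_wpM2l// -/(s _) -/(s _).
  rewrite lef_pV2 ?posrE ?mulr_gt0// ?exprn_gt0// expr2 ler_pM2r//.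
  apply: le_trans (ler_norm _) (halfsin_mono _ h2).
  by rewrite ger0_norm// ler_nat.
have lo : cot (d * w.+1%:R) - cot (d * m%:R) <= sin d * A.
  have -> : cot (d * w.+1%:R) - cot (d * m%:R) =
      \sum_(w.+1 <= j < m) (cot (d * j%:R) - cot (d * j.+1%:R)).
    rewrite -opprB -(telescope_sumr (fun j => cot (d * j%:R)))//.
    by rewrite -sumrN; apply: eq_bigr => j _; rewrite opprB.
  rewrite big_nat_recr//= mulrDr -[leLHS]addr0 lerD//; last first.
    by rewrite mulr_ge0// invr_ge0 sqr_ge0.
  rewrite mulr_sumr !big_nat; apply: ler_sum => j /andP[j1 j2].
  have [h1 h2] : w%:R <= j%:R :> R /\ 2 * j%:R <= N%:R :> R.
    by apply: window_range; rewrite j1 ltnW.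
  have [h3 h4] : w%:R <= j.+1%:R :> R /\ 2 * j.+1%:R <= N%:R :> R.
    by apply: window_range; rewrite (leqW j1) ltnS.
  have p1 := pos _ h1 h2; have p2 := pos _ h3 h4.
  rewrite cot_sub ?gt_eqF// dS ler_wpM2l// -/(s _) -/(s _).
  rewrite lef_pV2 ?posrE ?mulr_gt0// ?exprn_gt0// expr2 ler_pM2l//.
  apply: le_trans (ler_norm _) (halfsin_mono _ h4).
  by rewrite ger0_norm// ler_nat.
have [h1 h2] : w%:R <= w%:R :> R /\ 2 * w%:R <= N%:R :> R.
  by split => //; apply: le_trans m_le; rewrite ler_pM2l// ler_nat ltnW.
have [h3 h4] : w%:R <= w.+1%:R :> R /\ 2 * w.+1%:R <= N%:R :> R.
  by apply: window_range; rewrite leqnn ltnS.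
have := cot_near1 h1 h2; have := cot_near1 h3 h4; have := cot_end.
move=> /andP[e1 e2].
rewrite -[w.+1%:R]natr1 => n1 n2.
have {}n1 := n1 ltac:(lra); have {}n2 := n2 ltac:(lra).
have A0 : 0 <= A by apply: le_trans sum_inv_halfsin_ge; rewrite divr_ge0.
have AN := sum_inv_halfsin_le.
have dd : `|sin d * A - d * A| <= (56 * 56) / N%:R.
  rewrite -mulrBl normrM (ger0_norm A0).
  have := sin_approx d; rewrite (gtr0_norm d_gt0) => k.
  apply: (@le_trans _ _ (d ^+ 3 * (49 * N%:R))); first by rewrite ler_pM.
  have -> : d ^+ 3 * (49 * N%:R) = 49 * pi * d ^+ 2 by rewrite -dN; ring.
  have -> : (56 * 56) / N%:R = (56 * 56) / pi * d by rewrite -dN; field; rewrite !gt_eqF.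
  have hd : d * 100 <= pi by rewrite -dN ler_pM2l//; lra.
  have : (28 * 28) <= (56 * 56) / pi :> R by rewrite ler_pdivlMr; lra.
  move: ((56 * 56) / pi) => q h6.
  have : 49 * pi * d ^+ 2 <= (28 * 28) * d by rewrite expr2 mulrA ler_pM2r//; nra.
  by move=> /le_trans; apply; rewrite ler_pM2r.
clear pos dS A0 AN sd0 h1 h2 h3 h4.
move: up lo n1 n2 dd e1 e2 iN; rewrite -[w.+1%:R]natr1 !ler_norml.
move: (cot _) (cot _) (cot _) (sin d * A) (d * A) (N%:R^-1) => c1 c2 c3 X Y r.
by move=> up lo n1 n2 dd e1 e2 r0; lra.
Qed.

(** Each factor lies between 0 and exp (- u), u being the subtracted square. *)
Lemma window_ge0_le (x : R) : `|x| <= w%:R ->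
  0 <= window N w m x <= expR (- (s x ^+ 2 * A)).
Proof.
facts.
move=> xw; rewrite /window !big_nat mulr_sumr -sumrN expR_sum.
have h j : (w < j < m.+1)%N -> 0 <= (s x / s j%:R) ^+ 2 <= 1.
  move=> jr; have [h1 h2] := window_range jr; have h := halfsin_ge h1 h2.
  have p : 0 < s j%:R by lra.
  rewrite sqr_ge0/= -[leLHS]real_normK ?num_real// expr_le1//.
  rewrite normrM normfV (gtr0_norm p) ler_pdivrMr// mul1r.
  by apply: halfsin_mono => //; exact: le_trans h1.
apply/andP; split; first by apply: prodr_ge0 => j /h/andP[_]; rewrite subr_ge0.
apply: ler_prod => j jr; have /andP[u0 u1] := h j jr.
rewrite subr_ge0 u1 /= expr_div_n.
by have := expR_ge1Dx (- (s x ^+ 2 / s j%:R ^+ 2)).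
Qed.

(** For small x every subtracted square is at most 1/2, so the logarithm of the product
is linear in them up to twice the sum of the squares. *)
Lemma window_ge (x : R) : 40 * `|x| <= N%:R ->
  expR (- (s x ^+ 2 * A + (2 * 49 * 49) * N%:R * s x ^+ 4)) <= window N w m x.
Proof.
facts.
move=> xN; have dx : `|d * x| <= 10^-1.
  rewrite normrM gtr0_norm// -(@ler_pM2r _ N%:R)// mulrAC dN.
  by have := normr_ge0 x; nra.
have sx : s x ^+ 2 <= 98^-1.
  have := sin_abs_le (d * x); rewrite -/(s x) => h.
  rewrite -real_normK ?num_real//; have := normr_ge0 (s x); nra.
set u := fun j : nat => s x ^+ 2 / s j%:R ^+ 2.
have hu j : (w < j < m.+1)%N -> 0 <= u j <= 49 * s x ^+ 2.
  move=> jr; have [h1 h2] := window_range jr; have h := inv_halfsin_le h1 h2.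
  rewrite /u divr_ge0 ?sqr_ge0//= mulrC ler_wpM2r ?sqr_ge0//.
apply: (@le_trans _ _ (\prod_(w.+1 <= j < m.+1) expR (- (u j + 2 * u j ^+ 2)))).
  rewrite -expR_sum ler_expR sumrN lerN2 big_split /= mulr_sumr lerD2l -mulr_sumr.
  apply: (@le_trans _ _ (2 * \sum_(w.+1 <= j < m.+1) ((49 * 49) * s x ^+ 4))).
    rewrite ler_pM2l// !big_nat; apply: ler_sum => j /hu/andP[u0 u1].
    have -> : (49 * 49) * s x ^+ 4 = (49 * s x ^+ 2) ^+ 2 by ring.
    by rewrite ler_sqr ?nnegrE// (le_trans u0).
  rewrite sum_window_const; have s4 : 0 <= s x ^+ 4 by rewrite exprn_even_ge0.
  have := ler0n R w; have := m_le; nra.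
rewrite /window !big_nat; apply: ler_prod => j jr; rewrite expR_ge0 /=.
have -> : (s x / s j%:R) ^+ 2 = u j by rewrite expr_div_n.
have /andP[u0 u1] := hu j jr; apply: one_sub_ge_expR; apply/andP; split=> //; lra.
Qed.

Lemma angle_sqr (x : R) : (d * x) ^+ 2 = om N / 4 * (step R N * x) ^+ 2.
Proof. by rewrite exprMn [in RHS]exprMn step_sqr omE; field. Qed.

(** Weaker than the Gaussian exponent but valid on the whole range |x| <= w, where it
provides the decay that makes all error terms summable. *)
Lemma exponent_ge (x : R) : `|x| <= w%:R -> (step R N * x) ^+ 2 / 50 <= s x ^+ 2 * A.
Proof.
facts.
move=> xw; have w2 : 2 * w%:R <= N%:R :> R.
  by apply: le_trans m_le; rewrite ler_pM2l// ler_nat ltnW.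
have h : (d * x / 3) ^+ 2 <= s x ^+ 2.
  wlog x0 : x xw / 0 <= x => [hw|].
    have [/hw|/ltW] := leP 0 x; first exact.
    rewrite -oppr_ge0 => /hw; rewrite normrN /halfsin mulrN sinN mulNr !sqrrN; exact.
  have ax : d * x <= pi / 2 by apply: angle_le; have := ler_norm x; lra.
  have ax0 : 0 <= d * x by rewrite mulr_ge0// ltW.
  rewrite ler_sqr ?nnegrE ?divr_ge0//; last first.
    by apply: sin_ge0_pi; apply/andP; split; lra.
  by apply: sin_ge_third; apply/andP; split; lra.
apply: (@le_trans _ _ ((d * x / 3) ^+ 2 * (N%:R / 5))); last first.
  by rewrite ler_pM ?sqr_ge0 ?divr_ge0// sum_inv_halfsin_ge.
rewrite expr_div_n angle_sqr; set t2 := (_ * x) ^+ 2.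
have -> : om N / 4 * t2 / 3 ^+ 2 * (N%:R / 5) = (om N * N%:R) * t2 / 180 by field.
rewrite om_natM ?(balanced_pos bal)//.
have : 0 <= t2 by exact: sqr_ge0.
nra.
Qed.

Lemma window_decay (x : R) : `|x| <= w%:R ->
  0 <= window N w m x <= expR (- ((step R N * x) ^+ 2 / 50)).
Proof.
facts.
move=> xw; have /andP[-> h] := window_ge0_le xw; apply: le_trans h _.
by rewrite ler_expR lerN2 exponent_ge.
Qed.

Lemma angle_pow4_le (x : R) :
  (d * x) ^+ 4 * N%:R <= om N * (step R N * x) ^+ 4 / 2.
Proof.
have omN := om_natM R (balanced_pos bal).
have -> : (d * x) ^+ 4 * N%:R =
    (om N * N%:R) * (om N * (step R N * x) ^+ 4) / 16.
  by rewrite -[4%N]/(2 * 2)%N !exprM angle_sqr; field.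
have p : 0 <= om N * (step R N * x) ^+ 4 by rewrite mulr_ge0 ?exprn_even_ge0 ?om_ge0.
have := @pi_lt4 R; rewrite omN; move: (om N * _) p => y y0 p4.
by have : pi * y <= 4 * y; [rewrite ler_wpM2r// ltW | lra].
Qed.

Lemma halfsin_pow4_le (x : R) : s x ^+ 4 <= (d * x) ^+ 4.
Proof.
have sa : `|s x| <= `|d * x| by exact: sin_abs_le.
have e (y : R) : y ^+ 4 = `|y| ^+ 4.
  by rewrite -[4%N]/(2 * 2)%N !exprM real_normK ?num_real.
by rewrite e [leRHS]e lerXn2r ?nnegrE.
Qed.

Lemma halfsin_sqr_approx (x : R) : `|s x ^+ 2 - (d * x) ^+ 2| <= 2 * (d * x) ^+ 4.
Proof.
have sa : `|s x| <= `|d * x| by exact: sin_abs_le.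
have := sin_approx (d * x); rewrite -/(s x) => k.
rewrite subr_sqr normrM.
have -> : 2 * (d * x) ^+ 4 = `|d * x| ^+ 3 * (2 * `|d * x|).
  have -> : (d * x) ^+ 4 = `|d * x| ^+ 4.
    by rewrite -[4%N]/(2 * 2)%N !exprM real_normK ?num_real.
  by ring.
rewrite ler_pM//; apply: le_trans (ler_normD _ _) _; clear k; lra.
Qed.

(** Two replacements are made: sin^2 by the square of the angle, and the sum of the
inverse squares by 1 / half_om N; both cost a factor O(omega) times a polynomial
in the scaled variable. *)
Lemma exponent_approx (x : R) :
  `|s x ^+ 2 * A - (step R N * x) ^+ 2 / 2| <=
  (7 * c%:R + 100 * 100) * (om N * ((step R N * x) ^+ 2 + (step R N * x) ^+ 4)).
Proof.
have [[Nr_ge w_ge w_le m_ge m_le] [c_ge0 Nr_gt0 d_gt0 dN] [pi2 pi4]] := balanced_real bal.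
set t := step R N * x.
have A0 : 0 <= A.
  by apply: le_trans sum_inv_halfsin_ge; rewrite divr_ge0// ltW.
have a2 := angle_sqr x; rewrite -/t in a2.
have main : `|s x ^+ 2 * A - t ^+ 2 / 2| <=
    2 * (d * x) ^+ 4 * (49 * N%:R) + (d * x) ^+ 2 * ((14 * c%:R + 40 * 100) / pi).
  have -> : s x ^+ 2 * A - t ^+ 2 / 2 =
     (s x ^+ 2 - (d * x) ^+ 2) * A + (d * x) ^+ 2 * ((d * A - 1) / d).
    have e : (d * x) ^+ 2 / d = t ^+ 2 / 2.
      by rewrite a2 omE; field; rewrite gt_eqF.
    by rewrite -e; move: A => B; field; rewrite gt_eqF.
  apply: le_trans (ler_normD _ _) _.
  rewrite [`|(_ ^+ 2 - _) * _|]normrM [`|(d * x) ^+ 2 * _|]normrM [`|_ / d|]normrM lerD//.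
    by rewrite (ger0_norm A0); apply: ler_pM => //;
      [exact: halfsin_sqr_approx|exact: sum_inv_halfsin_le].
  rewrite (ger0_norm (sqr_ge0 (d * x))) ler_wpM2l ?sqr_ge0//.
  rewrite normfV (gtr0_norm d_gt0) ler_pdivrMr//.
  apply: le_trans sum_inv_halfsin_approx _.
  by rewrite -{1}dN -[leRHS]mulrA le_eqVlt; apply/orP; left; apply/eqP; field; rewrite !gt_eqF.
apply: le_trans main _; rewrite a2.
have h4 := angle_pow4_le x; rewrite -/t in h4.
have y0 : 0 <= om N * t ^+ 2 by rewrite mulr_ge0 ?sqr_ge0 ?om_ge0.
have z0 : 0 <= om N * t ^+ 4 by rewrite mulr_ge0 ?exprn_even_ge0 ?om_ge0.
have q : (14 * c%:R + 40 * 100) / pi <= 7 * c%:R + 40 * 50 :> R.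
  rewrite ler_pdivrMr ?pi_gt0//; have := mulr_ge0 c_ge0 (@pi_ge0 R).
  have : 2 * c%:R <= pi * c%:R :> R by rewrite ler_wpM2r.
  clear -bal pi2; lra.
have r : om N / 4 * t ^+ 2 * ((14 * c%:R + 40 * 100) / pi) <=
    om N / 4 * t ^+ 2 * (7 * c%:R + 40 * 50).
  by rewrite ler_wpM2l// mulrAC divr_ge0.
have cy := mulr_ge0 c_ge0 y0; have cz := mulr_ge0 c_ge0 z0.
have -> : 2 * (d * x) ^+ 4 * (49 * N%:R) = 98 * ((d * x) ^+ 4 * N%:R) by ring.
apply: le_trans (lerD (ler_wpM2l _ h4) r) _; first by [].
clear -bal y0 z0 cy cz; lra.
Qed.

Lemma exponent_approx_quartic (x : R) :
  `|s x ^+ 2 * A + 2 * 49 * 49 * N%:R * s x ^+ 4 - (step R N * x) ^+ 2 / 2| <=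
  (7 * c%:R + 200 * 200) * (om N * ((step R N * x) ^+ 2 + (step R N * x) ^+ 4)).
Proof.
rewrite addrAC; apply: le_trans (ler_normD _ _) _.
have h : `|2 * 49 * 49 * N%:R * s x ^+ 4| <= 49 * 49 * (om N * (step R N * x) ^+ 4).
  rewrite ger0_norm; last by rewrite mulr_ge0 ?exprn_even_ge0// mulr_ge0.
  have h1 := angle_pow4_le x.
  have h2 : s x ^+ 4 * N%:R <= (d * x) ^+ 4 * N%:R.
    by rewrite ler_wpM2r// halfsin_pow4_le.
  lra.
apply: le_trans (lerD (exponent_approx x) h) _.
have y0 : 0 <= om N * (step R N * x) ^+ 2 by rewrite mulr_ge0 ?sqr_ge0 ?om_ge0.
have z0 : 0 <= om N * (step R N * x) ^+ 4 by rewrite mulr_ge0 ?exprn_even_ge0 ?om_ge0.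
move: y0 z0; rewrite [om N * (_ + _)]mulrDr.
by move: (om N * _ ^+ 2) (om N * _ ^+ 4) => y z; lra.
Qed.

(** Where the lower bound for the window is not available, the scaled variable is so
large that the error term exceeds 1. *)
Lemma far_bound (x : R) : N%:R < 40 * `|x| ->
  1 <= 200 * 200 * (om N * (step R N * x) ^+ 4).
Proof.
have [[Nr_ge w_ge w_le m_ge m_le] [c_ge0 Nr_gt0 d_gt0 dN] [pi2 pi4]] := balanced_real bal.
move=> hx; have omN := om_natM R (balanced_pos bal).
set t := step R N * x; have t4 : t ^+ 4 = t ^+ 2 * t ^+ 2 by rewrite -exprD.
have N100 : 100 <= N%:R :> R by clear -bal Nr_ge c_ge0; lra.
have h1 : N%:R / 400 <= t ^+ 2.
  rewrite /t exprMn step_sqr -[x ^+ 2]real_normK ?num_real//.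
  have h : (N%:R / 40) ^+ 2 <= `|x| ^+ 2.
    by rewrite ler_sqr ?nnegrE ?divr_ge0 ?(ltW Nr_gt0)//; clear -bal hx; lra.
  apply: le_trans (ler_wpM2l (om_ge0 R N) h).
  have -> : om N * (N%:R / 40) ^+ 2 = (om N * N%:R) * N%:R / (40 * 40) by field.
  have : 2 * N%:R <= pi * N%:R :> R by rewrite ler_pM2r.
  rewrite omN; clear -bal; lra.
have h2 : 100^-1 <= om N * t ^+ 2.
  apply: le_trans (ler_wpM2l (om_ge0 R N) h1); rewrite mulrA omN; clear -bal pi2; lra.
have h3 : 100^-1 * (N%:R / 400) <= om N * t ^+ 2 * t ^+ 2.
  apply: ler_pM h2 h1; first by rewrite invr_ge0.
  by apply: divr_ge0; exact: ler0n.
rewrite t4 mulrA; clear -bal h3 N100; lra.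
Qed.

(** Both exponents are bounded below by the decay exponent, so the distance of the
exponentials is at most the distance of the exponents times the decaying factor. *)
Lemma window_approx (x : R) : `|x| <= w%:R ->
  `|window N w m x - expR (- ((step R N * x) ^+ 2 / 2))| <=
  (7 * c%:R + 200 * 200) * (om N * ((step R N * x) ^+ 2 + (step R N * x) ^+ 4))
    * expR (- ((step R N * x) ^+ 2 / 50)).
Proof.
move=> xw; have /andP[v0 vle] := window_decay xw.
have /andP[_ vle'] := window_ge0_le xw.
have b1 := exponent_approx x; have b2 := exponent_approx_quartic x.
have e1 := exponent_ge xw.
have lo := @window_ge x; have far := @far_bound x.
have t2 : 0 <= (step R N * x) ^+ 2 by exact: sqr_ge0.
have y0 : 0 <= om N * (step R N * x) ^+ 2 by rewrite mulr_ge0 ?om_ge0.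
have z0 : 0 <= om N * (step R N * x) ^+ 4 by rewrite mulr_ge0 ?exprn_even_ge0 ?om_ge0.
have c0 := ler0n R c.
have A4 : 0 <= 2 * 49 * 49 * N%:R * s x ^+ 4.
  by rewrite mulr_ge0 ?exprn_even_ge0// mulr_ge0.
have E1 : (step R N * x) ^+ 2 / 50 <= (step R N * x) ^+ 2 / 2 by clear -bal t2; lra.
have [x40|x40] := leP (40 * `|x|) N%:R; last first.
  have {}far := far x40.
  apply: (@le_trans _ _ (expR (- ((step R N * x) ^+ 2 / 50)))).
    have h1 := expR_ge0 (- ((step R N * x) ^+ 2 / 2)).
    have h2 : expR (- ((step R N * x) ^+ 2 / 2)) <= expR (- ((step R N * x) ^+ 2 / 50)).
      by rewrite ler_expR lerN2.
    by rewrite ler_norml; clear -bal h1 h2 v0 vle; lra.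
  rewrite ler_peMl ?expR_ge0// [om N * (_ + _)]mulrDr.
  have := mulr_ge0 c0 y0; have := mulr_ge0 c0 z0.
  move: far y0 z0; move: (om N * _ ^+ 2) (om N * _ ^+ 4) => y z; clear -bal; lra.
have {}lo := lo x40.
have b1' : `|s x ^+ 2 * A - (step R N * x) ^+ 2 / 2| <=
    (7 * c%:R + 200 * 200) * (om N * ((step R N * x) ^+ 2 + (step R N * x) ^+ 4)).
  apply: le_trans b1 _; rewrite ler_wpM2r//; last by clear -bal; lra.
  by rewrite mulrDr addr_ge0.
have e2 : (step R N * x) ^+ 2 / 50 <= s x ^+ 2 * A + 2 * 49 * 49 * N%:R * s x ^+ 4.
  by apply: le_trans e1 _; rewrite lerDl.
have k1 := le_trans (expR_dist e1 E1) (ler_wpM2r (expR_ge0 _) b1').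
have k2 := le_trans (expR_dist e2 E1) (ler_wpM2r (expR_ge0 _) b2).
by move: k1 k2; rewrite !ler_norml; clear -bal lo vle'; lra.
Qed.

End Estimates.
End Window.

(** * Labels, width, and the real form of the eigenvalue equation *)

Section Labels.
Variable (N : nat).
Implicit Types (j k : 'I_N).

Lemma lab_inj : injective (@lab N).
Proof. by move=> j k; rewrite /lab => h; apply: val_inj => /=; lia. Qed.

Lemma lab_abs_le j : `|lab j| <= (N./2)%:Z.
Proof. by rewrite /lab; have := ltn_ord j; lia. Qed.

Lemma lab_exists (k : nat) : (k <= N./2)%N -> (0 < N)%N -> exists j, lab j = k%:Z.
Proof.
move=> kN N0; have h : (k + (uphalf N).-1 < N)%N by lia.
by exists (Ordinal h); rewrite /lab /=; lia.
Qed.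

Lemma lab_mod_inj j k : (lab j = lab k %[mod N])%Z -> j = k.
Proof.
move/eqP; rewrite eqz_mod_dvd /lab => /dvdzP[q hq].
have := ltn_ord j; have := ltn_ord k => h1 h2.
apply: val_inj => /=; have : j%:Z - k%:Z = q * N%:Z by lia.
move=> {}hq; have [q0|q1|q1] : [\/ q = 0, 1 <= q | q <= -1].
  by case: (ltgtP q 0); [constructor 3|constructor 2|constructor 1]; lia.
- by move: hq; rewrite q0 mul0r; lia.
- have h3 : N%:Z <= q * N%:Z by rewrite ler_peMl.
  lia.
- have h3 : N%:Z <= - q * N%:Z by rewrite ler_peMl//; lia.
  by rewrite mulNr in h3; lia.
Qed.

Lemma pext_lab (K : nmodType) (a : 'rV[K]_N) j : pext a (lab j) = a 0 j.
Proof.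
rewrite /pext; case: pickP => [k /eqP /lab_mod_inj ->//|/(_ j)].
by rewrite eqxx.
Qed.

(** A nonzero vector has a nonzero entry of largest absolute label, so its width is
attained and bounds the support. *)
Lemma width_vanish (K : nmodType) (a : 'rV[K]_N) j : a != 0 ->
  (width a)%:Z < `|lab j| -> a 0 j = 0.
Proof.
move=> a0 hj.
have ex : exists n, is_width a n.
  pose P n := (n <= N./2)%N && `[< pext a n%:Z <> 0 \/ pext a (- n%:Z) <> 0 >].
  have exP : exists n, P n.
    have [k hk] : exists k, a 0 k != 0.
      apply/existsP; apply: contraNT a0 => /existsPn h; apply/eqP/rowP => k.
      by rewrite mxE; apply/eqP; move: (h k); rewrite negbK.
    exists `|lab k|%N; rewrite /P; have := lab_abs_le k => hl; apply/andP; split; first lia.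
    apply/asboolP; have [k0|k0] := leP 0 (lab k).
      by left; rewrite (_ : Posz _ = lab k) ?pext_lab; [exact/eqP|lia].
    by right; rewrite (_ : - Posz _ = lab k) ?pext_lab; [exact/eqP|lia].
  have bd n : P n -> (n <= N./2)%N by case/andP.
  case: (ex_maxnP exP bd) => n /andP[nN /asboolP hn] mx; exists n; split=> //.
  move=> k /andP[k1 k2]; apply/eqP; apply: contraT => /eqP hk.
  have /mx : P `|k|%N.
    apply/andP; split; first lia.
    apply/asboolP; have [k0|k0] := leP 0 k.
      by left; rewrite (_ : Posz _ = k); [exact: hk|lia].
    by right; rewrite (_ : - Posz _ = k); [exact: hk|lia].
  by lia.
have : is_width a (width a) by rewrite /width; case: ex => n hn; exact: (@xgetI _ _ _ n).
case=> _ _ h; rewrite -pext_lab; apply: h.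
by rewrite hj lab_abs_le.
Qed.

End Labels.

Section RealForm.
Variable R : realType.

(** The transform of a real vector has a cosine or a sine kernel according to the
parity of the exponent of - i in the eigenvalue. *)
Definition trig (b : bool) (t : R) : R := if b then sin t else cos t.

Local Notation re := (@complex.Re R).
Local Notation im := (@complex.Im R).

Lemma Re_sum (I : finType) (F : I -> R[i]) :
  re (\sum_i F i) = \sum_i re (F i).
Proof. by elim/big_rec2: _ => // i y x _ <-; case: (F i) x => [? ?] [? ?]. Qed.

Lemma Im_sum (I : finType) (F : I -> R[i]) :
  im (\sum_i F i) = \sum_i im (F i).
Proof. by elim/big_rec2: _ => // i y x _ <-; case: (F i) x => [? ?] [? ?]. Qed.

Lemma ReMr (x : R[i]) (a : R) : re (x * (a%:C)%C) = re x * a.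
Proof. by case: x => ? ? /=; rewrite mulr0 subr0. Qed.

Lemma ImMr (x : R[i]) (a : R) : im (x * (a%:C)%C) = im x * a.
Proof. by case: x => ? ? /=; rewrite mulr0 add0r. Qed.

Lemma expNi (n : nat) : (- 'i%C : R[i]) ^+ n =
  if odd n then Complex 0 (- (-1) ^+ n./2) else Complex ((-1) ^+ n./2) 0.
Proof.
have e2 : (- 'i%C : R[i]) ^+ 2 = -1.
  by rewrite sqrrN; apply/eqP; rewrite eq_complex /= !mulr0 !mul0r !mul1r sub0r addr0 oppr0 !eqxx.
have e k : (- 'i%C : R[i]) ^+ k.*2 = Complex ((-1) ^+ k) 0.
  rewrite -mul2n exprM e2; elim: k => [|k IH]; first by [].
  by rewrite !exprS IH !mulN1r; apply/eqP; rewrite eq_complex /= oppr0 !eqxx.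
rewrite -{1}[n]odd_double_half; case: (odd n); rewrite ?add0n ?e//.
rewrite add1n exprS e; apply/eqP; rewrite eq_complex /=.
by rewrite oppr0 !mulr0 !mul0r subr0 add0r mulN1r !eqxx.
Qed.

(** The power (- i)^n is real for even n and purely imaginary for odd n; taking the
real or the imaginary part of the eigenvalue equation leaves one kernel. *)
Lemma dft_eigen_real (N n : nat) (a : 'rV[R]_N) :
  dft (complexify a) = (- 'i%C) ^+ n *: complexify a ->
  forall l, a 0 l = (-1) ^+ n./2 / Num.sqrt N%:R *
    \sum_k trig (odd n) (omega R N * (lab k)%:~R * (lab l)%:~R) * a 0 k.
Proof.
move=> e l; have := congr1 (fun v : 'rV[R[i]]_N => v 0 l) e.
rewrite !mxE expNi [(Num.sqrt _)^-1%:C%C * _]mulrC.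
set s := (-1) ^+ n./2; have ss : s * s = 1 by rewrite -expr2 sqrr_sign.
case: (odd n) => /= h.
  have := congr1 (@complex.Im R) h; rewrite ImMr Im_sum ImMr /=.
  under eq_bigr => k _ do rewrite mxE ImMr /= sinN mulNr.
  rewrite sumrN => h2; rewrite -[RHS]mulrA [_^-1 * _]mulrC.
  by move: h2; rewrite mulNr mulNr => /oppr_inj ->; rewrite mulrA ss mul1r.
have := congr1 (@complex.Re R) h; rewrite ReMr Re_sum ReMr /=.
under eq_bigr => k _ do rewrite mxE ReMr /= cosN.
by move=> h2; rewrite -[RHS]mulrA [_^-1 * _]mulrC h2 mulrA ss mul1r.
Qed.

End RealForm.

(** * Chebyshev and Hermite polynomials by parity *)

Section Chebyshev.
Variable R : realType.

(** Consecutive Chebyshev polynomials: of the first kind when b is false; of the second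
kind, shifted by one index, when b is true. *)
Fixpoint cheb_pair (b : bool) (l : nat) : {poly R} * {poly R} :=
  if l is l'.+1 then
    let: (p, q) := cheb_pair b l' in (q, 'X * q *+ 2 - p)
  else if b then (0, 1) else (1, 'X).

Definition cheb b l := (cheb_pair b l).1.

Lemma cheb_pairE b l : cheb_pair b l = (cheb b l, cheb b l.+1).
Proof. by rewrite /cheb /=; case: (cheb_pair b l). Qed.

Lemma chebSS b l : cheb b l.+2 = 'X * cheb b l.+1 *+ 2 - cheb b l.
Proof. by rewrite {1}/cheb /= cheb_pairE /=; rewrite {1}/cheb cheb_pairE. Qed.

Lemma trig_cheb b l (t : R) :
  trig b (l%:R * t) = sin t ^+ b * (cheb b l).[cos t].
Proof.
suff : trig b (l%:R * t) = sin t ^+ b * (cheb b l).[cos t] /\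
  trig b (l.+1%:R * t) = sin t ^+ b * (cheb b l.+1).[cos t] by case.
elim: l => [|l [IH1 IH2]].
  rewrite mul0r mul1r /cheb; case: b => /=.
    by rewrite sin0 horner0 !hornerC mulr0 mulr1 expr1.
  by rewrite cos0 !hornerE.
split=> //; rewrite chebSS hornerD hornerN hornerMn hornerM hornerX mulrBr -IH1.
have -> : sin t ^+ b * (cos t * (cheb b l.+1).[cos t] *+ 2) =
    2 * cos t * trig b (l.+1%:R * t).
  by rewrite IH2 -mulr_natl; ring.
have -> : l.+2%:R * t = l.+1%:R * t + t by rewrite -[l.+2%:R]natr1; ring.
have -> : l%:R * t = l.+1%:R * t - t by rewrite -[l.+1%:R]natr1; ring.
by case: b {IH1 IH2} => /=; [rewrite sinD sinB|rewrite cosD cosB]; ring.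
Qed.

Lemma size_cheb b l : (size (cheb b l) <= l.+1 - b)%N.
Proof.
suff : (size (cheb b l) <= l.+1 - b)%N /\ (size (cheb b l.+1) <= l.+2 - b)%N by case.
elim: l => [|l [IH1 IH2]].
  by rewrite /cheb; case: b => /=; rewrite ?size_poly0 ?size_poly1 ?size_polyX.
split=> //; rewrite chebSS; apply: leq_trans (size_polyD _ _) _.
rewrite size_polyN geq_max; apply/andP; split; last first.
  by apply: leq_trans IH1 _; lia.
rewrite mulr2n; apply: leq_trans (size_polyD _ _) _; rewrite maxnn.
apply: leq_trans (size_polyMleq _ _) _; rewrite size_polyX.
by clear IH1; move: (size _) IH2 => s; case: (b); rewrite ?subn0 ?subn1; lia.
Qed.

Lemma cheb_lead_gt0 b l : 0 < (cheb b l.+1)`_(l.+1 - b).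
Proof.
elim: l => [|l IH].
  by rewrite /cheb; case: b => /=; rewrite ?coefX ?coef1.
rewrite chebSS coefB coefMn coefXM.
have -> : (l.+2 - b == 0)%N = false by case: b {IH}.
have -> : ((l.+2 - b).-1 = l.+1 - b)%N by case: b {IH}; rewrite ?subn1 ?subn0.
rewrite [X in _ - X]nth_default ?subr0 ?mulrn_wgt0//; last first.
  by apply: leq_trans (size_cheb b l) _; lia.
Qed.

(** The sign that a negative frequency produces: - 1 for the sine only. *)
Definition parity_sign (b : bool) (k : int) : R := if b && (k < 0) then -1 else 1.

Lemma trig_int b (k : int) (t : R) :
  trig b (k%:~R * t) = parity_sign b k * (sin t ^+ b * (cheb b `|k|%N).[cos t]).
Proof.
rewrite -trig_cheb /parity_sign; case: (intP k) => [|n|n].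
- by rewrite ltxx andbF mul1r.
- by rewrite ltNge lez_nat /= andbF mul1r.
- rewrite rmorphN /= mulNr.
  have -> : (- n.+1%:Z < 0) = true by lia.
  by case: b => /=; rewrite ?sinN ?cosN ?mulN1r ?mul1r.
Qed.

End Chebyshev.

Section HalfHermite.
Variable R : realType.

Lemma hermp_parity n i : odd (n + i) -> (hermp R n)`_i = 0.
Proof.
elim: n i => [|n IH] i; first by rewrite add0n coefC; case: i.
rewrite addSn oddS => h; rewrite coefN coefB coefMn coefXM coef_deriv.
rewrite IH; last by rewrite addnS oddS.
case: i h => [|i] h /=; first by rewrite mul0rn mul0rn subr0 oppr0.
by rewrite IH ?mul0rn ?subr0 ?oppr0//; move: h; rewrite addnS oddS negbK.
Qed.

(** The Hermite polynomial of index 2 j + b is x^b times a polynomial of degree j in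
x^2; this is the latter polynomial. *)
Definition half_herm (b : bool) (j : nat) : {poly R} :=
  if b then odd_poly (hermp R (j.*2 + b)) else even_poly (hermp R (j.*2 + b)).

Lemma half_hermE (b : bool) j (x : R) :
  (hermp R (j.*2 + b)).[x] = x ^+ b * (half_herm b j).[x ^+ 2].
Proof.
rewrite -{1}(poly_even_odd (hermp R _)) /half_herm hornerD hornerMX !horner_comp hornerXn.
case: b; rewrite ?addn0 ?addn1.
  have -> : even_poly (hermp R j.*2.+1) = 0.
    apply/polyP => i; rewrite coef_even_poly coef0 hermp_parity// oddD /= !odd_double//.
  by rewrite horner0 add0r mulrC.
have -> : odd_poly (hermp R j.*2) = 0.
  apply/polyP => i; rewrite coef_odd_poly coef0 hermp_parity// oddD /= !odd_double//.
by rewrite horner0 mul0r addr0 mul1r.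
Qed.

Lemma size_half_herm b j : (size (half_herm b j) <= j.+1)%N.
Proof.
rewrite /half_herm; case: b; rewrite ?addn0 ?addn1.
  apply: leq_trans (size_odd_poly _) _.
  by have := size_hermp R j.*2.+1; lia.
apply: leq_trans (size_even_poly _) _.
by have := size_hermp R j.*2; lia.
Qed.

Lemma half_herm_lead_gt0 b j : 0 < (half_herm b j)`_j.
Proof.
rewrite /half_herm; case: b; rewrite ?addn0 ?addn1 ?coef_odd_poly ?coef_even_poly.
  by rewrite lead_hermp exprn_gt0.
by rewrite lead_hermp exprn_gt0.
Qed.

End HalfHermite.

Section PolyTools.
Variable R : realType.

(** Elimination of the top coefficient by the only element of full degree. *)
Lemma graded_basis (B : nat -> {poly R}) n (q : {poly R}) :
  (forall j, (size (B j) <= j.+1)%N) -> (forall j, (B j)`_j != 0) ->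
  (size q <= n)%N -> exists c : nat -> R, q = \sum_(j < n) c j *: B j.
Proof.
move=> sB lB; elim: n q => [|n IH] q sq.
  exists (fun=> 0); rewrite big_ord0; apply/eqP; rewrite -size_poly_eq0; lia.
pose e := q`_n / (B n)`_n.
have /IH[c hc] : (size (q - e *: B n)%R <= n)%N.
  apply/leq_sizeP => i; rewrite leq_eqVlt => /orP[/eqP <-|ni].
    by rewrite coefB coefZ /e divfK// subrr.
  by rewrite coefB coefZ !nth_default ?mulr0 ?subr0// ?(leq_trans sq)// (leq_trans (sB n)).
exists (fun j => if j == n then e else c j).
rewrite big_ord_recr /= eqxx -[LHS](subrK (e *: B n)) hc; congr (_ + _).
by apply: eq_bigr => j _; rewrite ltn_eqF.
Qed.

Lemma sum_graded_coef (B : nat -> {poly R}) n (c : nat -> R) :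
  (forall j, (size (B j) <= j.+1)%N) ->
  (\sum_(j < n.+1) c j *: B j)`_n = c n * (B n)`_n.
Proof.
move=> sB; rewrite coef_sum big_ord_recr /= coefZ big1 ?add0r// => j _.
by rewrite coefZ nth_default ?mulr0// (leq_trans (sB j)).
Qed.

Lemma poly_upper (q : {poly R}) n : (size q <= n.+1)%N ->
  exists C, 0 <= C /\ forall y, 1 <= y -> `|q.[y]| <= C * y ^+ n.
Proof.
move=> sq; exists (\sum_(i < size q) `|q`_i|); split; first exact: sumr_ge0.
move=> y y1; rewrite horner_coef; apply: le_trans (ler_norm_sum _ _ _) _.
rewrite mulr_suml; apply: ler_sum => i _; rewrite normrM ler_wpM2l//.
rewrite normrX ger0_norm ?(le_trans ler01)// ler_weXn2l//.
by rewrite -ltnS (leq_trans _ sq).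
Qed.

Lemma poly_lower (q : {poly R}) n : (size q <= n.+1)%N -> 0 < q`_n ->
  exists Y, 1 <= Y /\ forall y, Y <= y -> q`_n / 2 * y ^+ n <= q.[y].
Proof.
case: n => [|n] sq qn.
  exists 1; split=> // y _.
  have -> : q = (q`_0)%:P by apply: size1_polyC.
  by rewrite hornerC coefC /= expr0; lra.
pose r := q - q`_n.+1 *: 'X^(n.+1).
have sr : (size r <= n.+1)%N.
  apply/leq_sizeP => i; rewrite leq_eqVlt => /orP[/eqP <-|ni].
    by rewrite coefB coefZ coefXn eqxx mulr1 subrr.
  by rewrite coefB coefZ coefXn (gtn_eqF ni) mulr0 subr0 nth_default// (leq_trans sq).
have [C [C0 hC]] := poly_upper sr.
exists (1 + 2 * C / q`_n.+1); split.
  by rewrite lerDl divr_ge0 ?mulr_ge0// ltW.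
move=> y hy; have y1 : 1 <= y.
  by apply: le_trans hy; rewrite lerDl divr_ge0 ?mulr_ge0// ltW.
have h := hC y y1.
have -> : q.[y] = r.[y] + q`_n.+1 * y ^+ n.+1.
  by rewrite /r hornerD hornerN hornerZ hornerXn subrK.
have k : C * y ^+ n <= q`_n.+1 / 2 * y ^+ n.+1.
  rewrite exprS mulrA ler_wpM2r ?exprn_ge0 ?(le_trans ler01)//.
  have : 2 * C / q`_n.+1 <= y by lra.
  by rewrite ler_pdivrMr//; lra.
by move: h; rewrite ler_norml => /andP[h1 _]; lra.
Qed.

End PolyTools.

(** * Eigenvectors of small width are windowed polynomials *)

Section PolyCoef.
Variable R : realType.

Lemma coef_exp_top (s : {poly R}) n : (size s <= 2)%N -> (s ^+ n)`_n = s`_1 ^+ n.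
Proof.
move=> ss; elim: n => [|n IH]; first by rewrite !expr0 coefC.
have e : s = (s`_0)%:P + s`_1 *: 'X.
  apply/polyP => i; rewrite coefD coefC coefZ coefX; case: i => [|[|i]] /=.
  - by rewrite mulr0 addr0.
  - by rewrite mulr1 add0r.
  - by rewrite mulr0 addr0 nth_default// (leq_trans ss).
rewrite exprS {1}e mulrDl coefD coefCM -scalerAl coefZ coefXM /= IH -exprS.
rewrite [(s ^+ n)`_n.+1]nth_default ?mulr0 ?add0r//.
apply: leq_trans (size_poly_exp_leq _ _) _; nia.
Qed.

Lemma coef_comp_top (q s : {poly R}) n : (size s <= 2)%N -> (size q <= n.+1)%N ->
  (q \Po s)`_n = q`_n * s`_1 ^+ n.
Proof.
move=> ss sq; rewrite comp_polyE coef_sum.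
have small i : (i < n)%N -> (s ^+ i)`_n = 0.
  move=> hi; rewrite nth_default//; apply: leq_trans (size_poly_exp_leq _ _) _; nia.
move: sq; rewrite leq_eqVlt => /orP[/eqP sq|sq].
  rewrite sq big_ord_recr /= coefZ coef_exp_top// big1 ?add0r// => i _.
  by rewrite coefZ small ?mulr0.
rewrite nth_default// mul0r big1// => i _.
by rewrite coefZ small ?mulr0//; apply: leq_trans (ltn_ord i) _.
Qed.

Lemma coef_mul_monic_top (q P : {poly R}) n d : P \is monic -> size P = d.+1 ->
  (size q <= n.+1)%N -> (q * P)`_(n + d) = q`_n.
Proof.
move=> mP sP sq; have [->|q0] := eqVneq q 0; first by rewrite mul0r !coef0.
have sz : size (q * P) = (size q + d)%N by rewrite size_Mmonic// sP addnS.
move: sq; rewrite leq_eqVlt => /orP[/eqP sq|sq].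
  have : lead_coef (q * P) = lead_coef q by rewrite lead_coef_Mmonic.
  by rewrite /lead_coef sz sq addSn.
by rewrite !nth_default// sz leq_add2r.
Qed.

End PolyCoef.

Section Expansion.
Variable R : realType.
Local Notation om := (omega R).

(** The variable in which the cofactor is expanded: it is affine in cos (omega x) and
close to omega x^2. *)
Definition height N (x : R) : R := 4 * halfsin N x ^+ 2 / om N.

(** The exact counterpart of the sampled Hermite function of index 2 j + b: the window
replaces the Gaussian, the height replaces the square of the scaled variable, and
sin (omega x) / step N replaces that variable. *)
Definition windowed_Psi N w m (b : bool) j : 'rV[R]_N := \row_l
  (let x : R := (lab l)%:~R in
   if `|lab l| <= w%:Z then
     om N `^ 4^-1 * kappa R (j.*2 + b) * (sin (om N * x) / step R N) ^+ b *
     window N w m x * (half_herm R b j).[height N x]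
   else 0).

(** Ties the leading coefficient of the cofactor to its value at the height of w. The
minus sign in front of rho is what limits c D. *)
Definition top_relation N w (b : bool) D (c : nat -> R) : Prop :=
  exists rho : R, 0 <= rho /\
    c D * (kappa R (D.*2 + b) * (half_herm R b D)`_D) =
    - rho * \sum_(j < D.+1) c j *
      (kappa R (j.*2 + b) * (half_herm R b j).[height N w%:R]).

Lemma cos_om N (x : R) : cos (om N * x) = 1 - 2 * halfsin N x ^+ 2.
Proof.
have -> : om N * x = (half_om R N * x) *+ 2 by rewrite omE -[RHS]mulr_natl mulrA.
by rewrite cos_mulr2n cos2sin2 /halfsin -mulr_natl; ring.
Qed.

Lemma cos_height N (x : R) : (0 < N)%N -> cos (om N * x) = 1 - om N / 2 * height N x.
Proof.
move=> N0; rewrite cos_om /height; field; rewrite gt_eqF// om_gt0//.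
Qed.

Section FixedVector.
Variables (N w m D : nat) (b : bool) (a : 'rV[R]_N).
Hypotheses (w0 : (0 < w)%N) (wm : (w < m)%N) (mN : (2 * m + b <= N)%N).
Hypothesis Dw : (w.+1 - b <= (m - w) + D.+1)%N.
Hypothesis window0 : 0 <= window N w m w%:R :> R.
Hypothesis fixed : forall l, a 0 l = (-1) ^+ D.+1 / Num.sqrt N%:R *
    \sum_k trig b (om N * (lab k)%:~R * (lab l)%:~R) * a 0 k.
Hypothesis vanish : forall l, w%:Z < `|lab l| -> a 0 l = 0.

Let N0 : (0 < N)%N. Proof. by move: mN wm; lia. Qed.
Local Notation eps := ((-1) ^+ D.+1 / Num.sqrt N%:R : R).
Local Notation angle l := (om N * (lab l)%:~R).

Let p : {poly R} := \sum_k (eps * (parity_sign R b (lab k) * a 0 k)) *: cheb R b `|lab k|%N.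

Lemma vectorE l : a 0 l = sin (angle l) ^+ b * p.[cos (angle l)].
Proof.
rewrite fixed /p horner_sum !mulr_sumr; apply: eq_bigr => k _.
have -> : angle k * (lab l)%:~R = (lab k)%:~R * angle l by ring.
rewrite trig_int hornerZ.
by move: ((-1) ^+ D.+1 / _) (sin _ ^+ b) => e s; ring.
Qed.

Lemma size_vector_poly : (size p <= w.+1 - b)%N.
Proof.
apply: (big_ind (fun q : {poly R} => size q <= w.+1 - b)%N).
- by rewrite size_poly0.
- by move=> q r hq hr; apply: leq_trans (size_polyD _ _) _; rewrite geq_max hq.
move=> k _; have [hk|hk] := leP `|lab k| w%:Z; last first.
  by rewrite vanish// mulr0 mulr0 scale0r size_poly0.
apply: leq_trans (size_scale_leq _ _) _; apply: leq_trans (size_cheb _ _ _) _.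
by apply: leq_sub2r; lia.
Qed.

Lemma vector_parity j k : lab k = - lab j -> a 0 k = (-1) ^+ b * a 0 j.
Proof.
move=> e; rewrite !vectorE e rmorphN /= mulrN sinN cosN mulrA.
by case: b; rewrite /= ?expr1 ?mulN1r ?expr0 ?mul1r.
Qed.

(** Only the frequencies w and - w reach the top degree, and the parity of the vector
makes their contributions equal. *)
Lemma vector_poly_coef j : lab j = w%:Z ->
  exists r : R, 0 <= r /\ p`_(w - b) = eps * (r * a 0 j).
Proof.
move=> hj; rewrite /p coef_sum.
pose S (x : R) := exists r : R, 0 <= r /\ x = eps * (r * a 0 j).
apply: (big_ind S).
- by exists 0; split=> //; rewrite mul0r mulr0.
- move=> x y [r [r0 ->]] [s [s0 ->]]; exists (r + s); split; first exact: addr_ge0.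
  by rewrite mulrDl mulrDr.
move=> k _; rewrite coefZ.
have [hk|hk|hk] := ltgtP `|lab k|%N w.
- exists 0; split=> //; rewrite mul0r mulr0 nth_default ?mulr0//.
  apply: leq_trans (size_cheb _ _ _) _; lia.
- by exists 0; split=> //; rewrite vanish ?mulr0 ?mul0r ?mulr0//; lia.
exists (cheb R b w)`_(w - b); split.
  by case: (w) w0 => // v _; rewrite ltW// cheb_lead_gt0.
rewrite hk; have -> : parity_sign R b (lab k) * a 0 k = a 0 j.
  have [k0|k0] := leP 0 (lab k).
    have -> : k = j by apply: lab_inj; lia.
    by rewrite /parity_sign hj ltNge lez_nat /= andbF mul1r.
  have e : lab k = - lab j by lia.
  rewrite (vector_parity e) /parity_sign k0 andbT.
  by case: b; rewrite /= ?expr1 ?expr0 ?mulN1r ?mul1r ?opprK.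
by rewrite -mulrA [a 0 j * _]mulrC.
Qed.

Lemma angle_pi (i : nat) : (2 * i <= N)%N -> 0 <= om N * i%:R <= pi.
Proof.
move=> iN; rewrite mulr_ge0 ?om_ge0//= /omega -mulrA [N%:R^-1 * _]mulrC mulrA.
rewrite ler_pdivrMr ?ltr0n// [2 * pi]mulrC -mulrA ler_pM2l ?pi_gt0//.
by rewrite -natrM ler_nat.
Qed.

Let nodes := [seq cos (om N * i%:R) | i <- index_iota w.+1 m.+1].

(** The entries at the labels w < l <= m vanish while sin (omega l) does not when it
occurs, because then l < N/2. Injectivity of the cosine on [0, pi] makes the
roots distinct. *)
Lemma vector_poly_factor : exists q, p = q * \prod_(x <- nodes) ('X - x%:P).
Proof.
apply: uniq_roots_prod_XsubC; last first.
  rewrite uniq_rootsE map_inj_in_uniq ?iota_uniq// => i k.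
  rewrite !mem_index_iota => /andP[i1 i2] /andP[k1 k2] h.
  have hi : (2 * i <= N)%N by lia.
  have hk : (2 * k <= N)%N by lia.
  have : om N * i%:R = om N * k%:R.
    by apply: cos_inj => //; rewrite in_itv /= angle_pi.
  by move/(mulfI _)/eqP; rewrite gt_eqF ?om_gt0// eqr_nat => /(_ isT)/eqP.
apply/allP => x /mapP[i + ->]; rewrite mem_index_iota => /andP[i1 i2].
have [|j hj] := @lab_exists N i _ N0; first lia.
have := vectorE j; rewrite vanish; last by rewrite hj; lia.
rewrite hj /= => /esym/eqP; rewrite mulf_eq0 => /orP[|//].
rewrite expf_eq0 => /andP[b0] /eqP sz.
have : 0 < sin (om N * i%:R).
  apply: sin_gt0_pi; rewrite mulr_gt0 ?om_gt0 ?ltr0n//=; last lia.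
  rewrite /omega -mulrA [N%:R^-1 * _]mulrC mulrA ltr_pdivrMr ?ltr0n//.
  rewrite [2 * pi]mulrC -mulrA ltr_pM2l ?pi_gt0// -natrM ltr_nat.
  by move: b0 mN; case: (b) => //= _; lia.
by rewrite sz ltxx.
Qed.

(** Both sides have the same zeros; cos (omega x) - cos (omega i) is twice the
difference of two squared half sines. *)
Lemma window_prod (x : R) : (forall i : nat, (w < i <= m)%N -> halfsin N i%:R != 0 :> R) ->
  \prod_(y <- nodes) (cos (om N * x) - y) =
  (\prod_(w.+1 <= i < m.+1) (2 * halfsin N i%:R ^+ 2)) * window N w m x.
Proof.
move=> nz; rewrite /nodes big_map /window -big_split /=.
rewrite -[in LHS]/(index_iota w.+1 m.+1) !big_nat; apply: eq_bigr => i hi.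
have := nz i hi; rewrite !cos_om => h; field; exact: h.
Qed.

(** The hypothesis on w, m and D counts degrees: p has degree at most w - b, and m - w
of it are spent on the known roots. *)
Lemma window_expansion : exists c : nat -> R,
  a = \sum_(j < D.+1) c j *: windowed_Psi N w m b j /\ top_relation N w b D c.
Proof.
have om0 := om_gt0 R N0.
have st0 : 0 < step R N by rewrite /step sqrtr_gt0.
have nz (i : nat) : (w < i <= m)%N -> halfsin N i%:R != 0 :> R.
  move=> hi; rewrite gt_eqF// /halfsin; apply: sin_gt0_pi.
  have : 0 < om N * i%:R by rewrite mulr_gt0 ?ltr0n//; lia.
  have : om N * i%:R <= pi by have /andP[] := @angle_pi i ltac:(lia).
  by rewrite omE; have := @pi_gt0 R; lra.
have [q0 hq0] := vector_poly_factor.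
set P := \prod_(x <- nodes) ('X - x%:P) in hq0.
have mP : P \is monic by exact: monic_prod_XsubC.
have sP : size P = (m - w).+1 by rewrite size_prod_XsubC size_map size_iota subSS.
have sq0 : (size q0 <= D.+1)%N.
  have [->|qn0] := eqVneq q0 0; first by rewrite size_poly0.
  have := size_vector_poly; rewrite hq0 size_Mmonic// sP addnS /= => h.
  by rewrite -(leq_add2r (m - w)) (leq_trans h)// addnC.
pose Pi0 : R := \prod_(w.+1 <= i < m.+1) (2 * halfsin N i%:R ^+ 2).
have Pi0_gt0 : 0 < Pi0.
  rewrite /Pi0 big_nat; apply: prodr_gt0 => i hi.
  by rewrite mulr_gt0// exprn_even_gt0//= nz.
(* Pi0 turns the product over the roots into the window; the other two factors are
those of windowed_Psi that do not depend on the polynomial. *)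
pose K := Pi0 * step R N ^+ b / om N `^ 4^-1.
have rt0 : 0 < om N `^ 4^-1 by rewrite powR_gt0.
have K0 : 0 < K by rewrite divr_gt0// mulr_gt0// exprn_gt0.
(* By cos_height, cos (omega x) is this polynomial at the height of x; its negative
slope is the source of the sign (-1)^D below. *)
pose lin : {poly R} := 1%:P - (om N / 2) *: 'X.
have slin : (size lin <= 2)%N.
  apply: leq_trans (size_polyD _ _) _; rewrite size_polyN geq_max size_polyC.
  apply/andP; split; first by case: eqP.
  by apply: leq_trans (size_scale_leq _ _) _; rewrite size_polyX.
pose q := K *: (q0 \Po lin).
have sq : (size q <= D.+1)%N.
  apply: leq_trans (size_scale_leq _ _) _.
  have [s1|s1] := leqP (size q0) 0.
    by move: s1; rewrite leqn0 size_poly_eq0 => /eqP ->; rewrite comp_poly0 size_poly0.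
  apply: leq_trans (size_comp_poly_leq _ _) _.
  case: (size lin) slin => [|[|[|//]]] _ /=; rewrite ?muln0 ?muln1//.
  by move: (size q0) sq0 s1 => y; lia.
have qh (x : R) : q.[height N x] = K * q0.[cos (om N * x)].
  rewrite hornerZ horner_comp; congr (_ * q0.[_]).
  by rewrite /lin hornerD hornerN hornerC hornerZ hornerX cos_height.
have aE l : a 0 l = om N `^ 4^-1 * (sin (angle l) / step R N) ^+ b *
    window N w m (lab l)%:~R * q.[height N (lab l)%:~R].
  rewrite qh vectorE hq0 hornerM horner_prod.
  under eq_bigr => y _ do rewrite hornerXsubC.
  rewrite window_prod// -/Pi0 /K expr_div_n; field.
  by rewrite !gt_eqF ?exprn_gt0.
pose B j := kappa R (j.*2 + b) *: half_herm R b j.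
have sB j : (size (B j) <= j.+1)%N.
  by apply: leq_trans (size_scale_leq _ _) (size_half_herm _ _ _).
have lB j : (B j)`_j != 0.
  by rewrite coefZ mulf_neq0// gt_eqF ?kappa_gt0 ?half_herm_lead_gt0.
have [c hc] := graded_basis sB lB sq.
exists c; split.
  apply/rowP => l; rewrite summxE.
  have [hl|hl] := leP `|lab l| w%:Z; last first.
    rewrite vanish// big1// => j _; rewrite !mxE lt_geF ?mulr0//.
  rewrite aE hc horner_sum mulr_sumr; apply: eq_bigr => j _.
  rewrite !mxE hl /B !hornerZ; ring.
have wN : (w <= N./2)%N by clear -wm mN; lia.
have [jw hjw] := lab_exists wN N0.
have [r [r0 hr]] := vector_poly_coef hjw.
have top : exists r : R, 0 <= r /\ q0`_D = eps * (r * a 0 jw).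
  rewrite -(coef_mul_monic_top mP sP sq0) -hq0.
  have [e|e] := eqVneq (D + (m - w))%N (w - b)%N; first by rewrite e; exists r.
  exists 0; split=> //; rewrite nth_default ?mul0r ?mulr0//.
  apply: leq_trans size_vector_poly _.
  by clear -Dw e w0; move: Dw e w0; case: (b); lia.
have [{r r0 hr} r [r0 hr]] := top.
have qD : q`_D = c D * (kappa R (D.*2 + b) * (half_herm R b D)`_D).
  by rewrite hc sum_graded_coef// coefZ.
have qY : \sum_(j < D.+1) c j * (kappa R (j.*2 + b) * (half_herm R b j).[height N w%:R]) =
    q.[height N w%:R].
  by rewrite hc horner_sum; apply: eq_bigr => j _; rewrite !hornerZ.
rewrite /top_relation qY -qD.
(* The change of variable contributes (om / 2)^D, the factor K and the frequencies w
and - w contribute K r, 1 / sqrt N normalises the transform, and the remaining factors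
express the entry of a at w. *)
exists ((om N / 2) ^+ D * (K * (r * (om N `^ 4^-1 * (sin (om N * w%:R) / step R N) ^+ b *
    window N w m w%:R)) / Num.sqrt N%:R)).
have sw : 0 <= sin (om N * w%:R).
  by apply: sin_ge0_pi; apply: angle_pi; clear -wm mN; lia.
split.
  have h1 : 0 <= om N `^ 4^-1 * (sin (om N * w%:R) / step R N) ^+ b * window N w m w%:R.
    apply: mulr_ge0 => //; apply: mulr_ge0; first exact: ltW.
    by rewrite exprn_ge0// divr_ge0// ltW.
  have h2 := mulr_ge0 (ltW K0) (mulr_ge0 r0 h1).
  apply: mulr_ge0; last by rewrite divr_ge0// sqrtr_ge0.
  by apply: exprn_ge0; rewrite divr_ge0// ltW.
rewrite {1}/q coefZ coef_comp_top// hr aE hjw -[(w%:Z)%:~R]/(w%:R : R).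
have -> : lin`_1 = - (om N / 2).
  by rewrite /lin coefB coefZ coefX coefC /= mulr1 sub0r.
have -> : (- (om N / 2)) ^+ D = (-1) ^+ D * (om N / 2) ^+ D by rewrite -[- (om N / 2)]mulN1r exprMn.
have s1 : (-1) ^+ D.+1 * (-1) ^+ D = -1 :> R.
  by rewrite exprS -mulrA -expr2 sqrr_sign mulr1.
move: s1; move: ((-1) ^+ D.+1) ((-1) ^+ D) ((om N / 2) ^+ D) (Num.sqrt _)^-1.
move: (_ ^+ b) (window _ _ _ _) q.[_] => e5 e6 e7 e1 e2 e3 e4 s1.
by rewrite mulNr -[RHS]mulN1r -s1; ring.
Qed.

End FixedVector.
End Expansion.

(** * Windowed Hermite polynomials against Hermite functions *)

Section Approximation.
Variable R : realType.
Local Notation om := (omega R).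

(** Size and Lipschitz constant of a polynomial on [- s, s], with the same polynomial
bound in s for both. *)
Lemma poly_lipschitz (p : {poly R}) : exists K m, 0 <= K /\
  forall s y z : R, `|y| <= s -> `|z| <= s ->
    `|p.[y]| <= K * (1 + s) ^+ m /\
    `|p.[y] - p.[z]| <= K * (1 + s) ^+ m * `|y - z|.
Proof.
elim/poly_ind: p => [|p c [K [m [K0 hK]]]].
  by exists 0, 0%N; split=> // s y z _ _; rewrite !horner0 subrr normr0 !mul0r.
exists (2 * K + `|c|), m.+1; split; first by rewrite addr_ge0 ?mulr_ge0.
move=> s y z ys zs; have [h1 h2] := hK s y z ys zs.
have s0 : 0 <= s by apply: le_trans ys.
have Z1 : 1 <= (1 + s) ^+ m by rewrite exprn_ege1// lerDl.
have Z0 : 0 <= (1 + s) ^+ m by rewrite (le_trans ler01).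
have c0 := normr_ge0 c; have KZ := mulr_ge0 K0 Z0.
have zz : 1 <= (1 + s) ^+ m.+1 by rewrite exprn_ege1// lerDl.
rewrite !hornerMXaddC; split.
  apply: le_trans (ler_normD _ _) _; rewrite mulrDl lerD//; last by rewrite ler_peMr.
  rewrite normrM exprSr mulrA ler_pM//; last by apply: le_trans ys _; rewrite lerDr.
  by apply: le_trans h1 _; rewrite ler_wpM2r// ler_peMl// ler1n.
have -> : p.[y] * y + c - (p.[z] * z + c) = p.[y] * (y - z) + z * (p.[y] - p.[z]) by ring.
apply: le_trans (ler_normD _ _) _; rewrite !normrM.
have d0 := normr_ge0 (y - z).
apply: (@le_trans _ _ (2 * K * (1 + s) ^+ m.+1 * `|y - z|)); last first.
  by rewrite ler_wpM2r// ler_wpM2r ?(le_trans ler01)// lerDl.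
have k1 : `|p.[y]| * `|y - z| <= K * (1 + s) ^+ m.+1 * `|y - z|.
  rewrite ler_wpM2r//; apply: le_trans h1 _.
  by rewrite ler_wpM2l// exprSr ler_peMr// lerDl.
have k2 : `|z| * `|p.[y] - p.[z]| <= K * (1 + s) ^+ m.+1 * `|y - z|.
  have -> : K * (1 + s) ^+ m.+1 * `|y - z| = (1 + s) * (K * (1 + s) ^+ m * `|y - z|).
    by rewrite exprS; ring.
  by apply: ler_pM => //; apply: le_trans zs _; rewrite lerDr.
by move: k1 k2; rewrite -!mulrA; lra.
Qed.

Lemma sin_scaled (N : nat) (x : R) : (0 < N)%N ->
  `|sin (om N * x) / step R N - step R N * x| <= om N * `|step R N * x| ^+ 3 /\
  `|sin (om N * x) / step R N| <= `|step R N * x|.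
Proof.
move=> N0; have st0 : 0 < step R N by rewrite /step sqrtr_gt0 om_gt0.
set t := step R N * x.
have -> : om N * x = step R N * t by rewrite /t -step_sqr; ring.
split; last first.
  rewrite normrM normfV (gtr0_norm st0) ler_pdivrMr// mulrC.
  by apply: le_trans (sin_abs_le _) _; rewrite normrM (gtr0_norm st0).
have -> : sin (step R N * t) / step R N - t = (sin (step R N * t) - step R N * t) / step R N.
  by field; rewrite gt_eqF.
rewrite normrM normfV (gtr0_norm st0) ler_pdivrMr//.
apply: le_trans (sin_approx _) _.
by rewrite normrM (gtr0_norm st0) exprMn -step_sqr le_eqVlt; apply/orP; left; apply/eqP; ring.
Qed.

Lemma height_approx (N : nat) (x : R) : (0 < N)%N ->
  `|height N x - (step R N * x) ^+ 2| <= om N * (step R N * x) ^+ 4 /\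
  `|height N x| <= (step R N * x) ^+ 2.
Proof.
move=> N0; have om0 := om_gt0 R N0.
have a2 := angle_sqr N x.
have t4 : (half_om R N * x) ^+ 4 = om N ^+ 2 / 16 * (step R N * x) ^+ 4.
  by rewrite -[4%N]/(2 * 2)%N !exprM a2; field.
split.
  have -> : height N x - (step R N * x) ^+ 2 =
      4 / om N * (halfsin N x ^+ 2 - (half_om R N * x) ^+ 2).
    by rewrite a2 /height; field; rewrite gt_eqF.
  have p0 : 0 <= 4 / om N by apply: divr_ge0 => //; exact: ltW.
  rewrite normrM (ger0_norm p0).
  apply: le_trans (ler_wpM2l p0 (halfsin_sqr_approx _ _)) _.
  rewrite t4; have -> : 4 / om N * (2 * (om N ^+ 2 / 16 * (step R N * x) ^+ 4)) =
      om N * (step R N * x) ^+ 4 / 2 by field; rewrite gt_eqF.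
  have : 0 <= om N * (step R N * x) ^+ 4 by apply: mulr_ge0; [exact: ltW|rewrite exprn_even_ge0].
  by lra.
rewrite /height ger0_norm; last by apply: divr_ge0; [rewrite mulr_ge0 ?sqr_ge0|exact: ltW].
rewrite ler_pdivrMr//.
have -> : (step R N * x) ^+ 2 * om N = 4 * (half_om R N * x) ^+ 2 by rewrite a2; field.
rewrite ler_pM2l// -[leLHS]real_normK ?num_real// -[leRHS]real_normK ?num_real//.
by rewrite lerXn2r ?nnegrE// sin_abs_le.
Qed.

Lemma PsiE N (b : bool) j l : Psi R N (j.*2 + b) 0 l =
  om N `^ 4^-1 * (kappa R (j.*2 + b) * (node R l ^+ b * (half_herm R b j).[node R l ^+ 2] *
    expR (- (node R l ^+ 2 / 2)))).
Proof. by rewrite mxE hermiteE half_hermE -/(node R l) !mulrA. Qed.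

(** A product of three factors is replaced one factor at a time. Here O is the small
parameter, Z = 1 + t^2 measures polynomial growth and E is the common decay. *)
Lemma product_perturbation (O Z E u ub V G BH BT K L : R) (n : nat) :
  0 <= O -> 1 <= Z -> 0 <= E -> 0 <= K -> 0 <= L ->
  `|u - ub| <= O * Z ^+ 2 -> `|ub| <= Z -> `|V| <= E -> `|V - G| <= L * (O * Z ^+ 2) * E ->
  `|G| <= E -> `|BH| <= K * Z ^+ n -> `|BH - BT| <= K * Z ^+ n * (O * Z ^+ 2) ->
  `|u * V * BH - ub * BT * G| <= (2 + L) * K * (O * (Z ^+ (n + 3) * E)).
Proof.
move=> O0 Z1 E0 K0 L0 h1 h2 h3 h4 h5 h6 h7.
have -> : u * V * BH - ub * BT * G =
    (u - ub) * V * BH + ub * (V - G) * BH + ub * G * (BH - BT) by ring.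
have Z0 : 0 <= Z by apply: le_trans Z1.
have Zn : 0 <= Z ^+ n by apply: exprn_ge0.
have p0 : 0 <= O * Z ^+ 2 by rewrite mulr_ge0 ?exprn_ge0.
have e1 : `|(u - ub) * V * BH| <= O * Z ^+ 2 * E * (K * Z ^+ n).
  by rewrite !normrM ler_pM ?mulr_ge0// ler_pM.
have e2 : `|ub * (V - G) * BH| <= Z * (L * (O * Z ^+ 2) * E) * (K * Z ^+ n).
  by rewrite !normrM ler_pM ?mulr_ge0// ler_pM.
have e3 : `|ub * G * (BH - BT)| <= Z * E * (K * Z ^+ n * (O * Z ^+ 2)).
  by rewrite !normrM ler_pM ?mulr_ge0// ler_pM.
apply: le_trans (ler_normD _ _) _.
apply: le_trans (lerD (ler_normD _ _) (lexx _)) _.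
apply: le_trans (lerD (lerD e1 e2) e3) _.
rewrite exprD; move: (Z ^+ n) Zn => Y Y0.
have q : O * Z ^+ 2 * E * (K * Y) <= O * Z ^+ 3 * E * (K * Y).
  rewrite ler_wpM2r ?mulr_ge0// ler_wpM2r// ler_wpM2l// [Z ^+ 3]exprS.
  by rewrite ler_peMl// exprn_ge0.
by move: q; lra.
Qed.

(** Inside the support the three factors are close one by one. Outside, omega (1 + t^2)
is bounded below, so the decay of the Hermite function alone is O(omega). *)
Lemma windowed_Psi_pointwise (b : bool) j c : exists C, 0 <= C /\
  forall N w m, balanced c N w m -> forall l,
  `|windowed_Psi R N w m b j 0 l - Psi R N (j.*2 + b) 0 l| <=
    C * om N * (om N `^ 4^-1 / (1 + node R l ^+ 2)).
Proof.
have [K [n [K0 hK]]] := poly_lipschitz (half_herm R b j).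
have c50 : 0 < 50^-1 :> R by rewrite invr_gt0.
have [C [C0 hC]] := pow_expR_bounded (n + 3).+1 c50.
set L := (7 * c%:R + 200 * 200 : R).
have L0 : 0 <= L by rewrite /L; apply: addr_ge0; apply: mulr_ge0; exact: ler0n.
exists (kappa R (j.*2 + b) * ((2 + L) * K * C)); split.
  by rewrite mulr_ge0 ?(ltW (kappa_gt0 _ _))// mulr_ge0// mulr_ge0// addr_ge0.
move=> N w m bal l; have N0 : (0 < N)%N by case: bal; lia.
have O0 := om_ge0 R N; have kap0 := ltW (kappa_gt0 R (j.*2 + b)).
have r0 : 0 <= om N `^ 4^-1 by exact: powR_ge0.
rewrite PsiE; set t := node R l.
have Zge1 : 1 <= 1 + t ^+ 2 by rewrite lerDl sqr_ge0.
have Zgt0 : 0 < 1 + t ^+ 2 by apply: lt_le_trans Zge1.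
have t2 : 0 <= t ^+ 2 by exact: sqr_ge0.
have E0 := expR_ge0 (- (t ^+ 2 / 50)).
have G0 := expR_ge0 (- (t ^+ 2 / 2)).
have GE : expR (- (t ^+ 2 / 2)) <= expR (- (t ^+ 2 / 50)).
  by rewrite ler_expR; clear -t2; lra.
have t_le : `|t| <= 1 + t ^+ 2.
  rewrite ler_norml; have := sqr_ge0 (t - 1); have := sqr_ge0 (t + 1).
  by rewrite sqrrB1 sqrrD1 -mulr_natl; clear -t2; lra.
have tb : `|t ^+ b| <= 1 + t ^+ 2.
  by case: (b); rewrite /= ?expr1 ?expr0 ?normr1.
suff core : `|(if `|lab l| <= w%:Z then (sin (om N * (lab l)%:~R) / step R N) ^+ b *
      window N w m (lab l)%:~R * (half_herm R b j).[height N (lab l)%:~R] else 0) -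
    t ^+ b * (half_herm R b j).[t ^+ 2] * expR (- (t ^+ 2 / 2))| <=
    (2 + L) * K * (om N * ((1 + t ^+ 2) ^+ (n + 3) * expR (- (t ^+ 2 / 50)))).
  have hCt := hC t; rewrite exprSr mulrAC in hCt.
  have hE : (1 + t ^+ 2) ^+ (n + 3) * expR (- (t ^+ 2 / 50)) <= C / (1 + t ^+ 2).
    by rewrite ler_pdivlMr// [t ^+ 2 / 50]mulrC.
  have {}core : `|(if `|lab l| <= w%:Z then (sin (om N * (lab l)%:~R) / step R N) ^+ b *
      window N w m (lab l)%:~R * (half_herm R b j).[height N (lab l)%:~R] else 0) -
    t ^+ b * (half_herm R b j).[t ^+ 2] * expR (- (t ^+ 2 / 2))| <=
    (2 + L) * K * (om N * (C / (1 + t ^+ 2))).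
    apply: le_trans core _; apply: ler_wpM2l; first by rewrite mulr_ge0// addr_ge0.
    exact: ler_wpM2l.
  rewrite mxE; cbv zeta.
  set X := (if _ then _ else _) in core; set Y := _ * _ * expR _ in core.
  have -> : (if `|lab l| <= w%:Z then om N `^ 4^-1 * kappa R (j.*2 + b) *
      (sin (om N * (lab l)%:~R) / step R N) ^+ b * window N w m (lab l)%:~R *
      (half_herm R b j).[height N (lab l)%:~R] else 0) = om N `^ 4^-1 * kappa R (j.*2 + b) * X.
    by rewrite /X; case: ifP => _; rewrite ?mulr0// !mulrA.
  rewrite -/Y mulrA -mulrBr normrM ger0_norm ?mulr_ge0//.
  apply: le_trans (ler_wpM2l _ core) _; first by rewrite mulr_ge0.
  by rewrite le_eqVlt; apply/orP; left; apply/eqP; ring.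
have [hl|hl] := leP `|lab l| w%:Z.
  have xw : `|(lab l)%:~R| <= w%:R :> R by rewrite -intr_norm -[w%:R]/((w%:Z)%:~R : R) ler_int.
  have [s1 s2] := sin_scaled (lab l)%:~R N0; rewrite -/(node R l) -/t in s1 s2.
  have [h1 h2] := height_approx (lab l)%:~R N0; rewrite -/(node R l) -/t in h1 h2.
  have /andP[v0 vE] := window_decay bal xw; rewrite -/(node R l) -/t in vE.
  have vG := window_approx bal xw; rewrite -/(node R l) -/t -/L in vG.
  have tt : `|t ^+ 2| <= t ^+ 2 by rewrite ger0_norm.
  have [k1 k2] := hK (t ^+ 2) _ _ h2 tt.
  have ta : `|t| ^+ 3 <= (1 + t ^+ 2) ^+ 2.
    rewrite exprS real_normK ?num_real// [leRHS]expr2.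
    by apply: ler_pM => //; rewrite lerDr.
  have t24 : t ^+ 2 + t ^+ 4 <= (1 + t ^+ 2) ^+ 2.
    by have -> : (1 + t ^+ 2) ^+ 2 = 1 + 2 * t ^+ 2 + t ^+ 4; [ring|clear -t2; lra].
  apply: product_perturbation => //.
  - case: (b) => /=; rewrite ?expr1 ?expr0 ?subrr ?normr0; last first.
      by rewrite mulr_ge0// exprn_ge0// ltW.
    by apply: le_trans s1 _; rewrite ler_wpM2l.
  - by rewrite ger0_norm.
  - apply: le_trans vG _; rewrite ler_wpM2r// ler_wpM2l// ler_wpM2l//.
  - by rewrite ger0_norm.
  - apply: le_trans k2 _; apply: ler_wpM2l.
      by rewrite mulr_ge0// exprn_ge0// ltW.
    apply: le_trans h1 _; rewrite ler_wpM2l//; apply: le_trans t24.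
    by rewrite lerDr.
rewrite sub0r normrN.
have tt : `|t ^+ 2| <= t ^+ 2 by rewrite ger0_norm.
have [k1 _] := hK (t ^+ 2) _ _ tt tt.
have far : 1 <= 2 * (om N * (1 + t ^+ 2)).
  have [[Nr_ge w_ge _ _ _] [c_ge0 Nr_gt0 _ _] [pi2 _]] := balanced_real R bal.
  have omN := om_natM R N0.
  have h1 : N%:R / 5 <= `|(lab l)%:~R| :> R.
    have : w%:R <= `|(lab l)%:~R| :> R by rewrite -intr_norm -[w%:R]/((w%:Z)%:~R : R) ler_int ltW.
    by clear -Nr_ge w_ge c_ge0; lra.
  have h2 : om N * (N%:R / 5) ^+ 2 <= t ^+ 2.
    rewrite /t /node [leRHS]exprMn step_sqr; apply: ler_wpM2l => //.
    rewrite -[leRHS]real_normK ?num_real//.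
    by rewrite lerXn2r ?nnegrE ?divr_ge0.
  have h3 : om N * (om N * (N%:R / 5) ^+ 2) <= om N * t ^+ 2 by rewrite ler_wpM2l.
  have h4 : om N * (om N * (N%:R / 5) ^+ 2) = (2 * pi) ^+ 2 / 25 by rewrite -omN; field.
  have h5 : 4 <= pi * pi :> R by clear -pi2; nra.
  by rewrite h4 in h3; rewrite mulrDr; clear -h3 O0 h5; lra.
rewrite !normrM (ger0_norm G0).
apply: (@le_trans _ _ ((1 + t ^+ 2) * (K * (1 + t ^+ 2) ^+ n) * expR (- (t ^+ 2 / 50)))).
  by rewrite ler_pM ?mulr_ge0// ler_pM.
have Q0 : 0 <= K * ((1 + t ^+ 2) ^+ n.+1 * expR (- (t ^+ 2 / 50))).
  by rewrite mulr_ge0// mulr_ge0// exprn_ge0// ltW.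
have -> : (1 + t ^+ 2) * (K * (1 + t ^+ 2) ^+ n) * expR (- (t ^+ 2 / 50)) =
   K * ((1 + t ^+ 2) ^+ n.+1 * expR (- (t ^+ 2 / 50))) by rewrite [_ ^+ n.+1]exprS; ring.
apply: le_trans (ler_peMr Q0 far) _.
have -> : K * ((1 + t ^+ 2) ^+ n.+1 * expR (- (t ^+ 2 / 50))) * (2 * (om N * (1 + t ^+ 2))) =
   2 * K * (om N * ((1 + t ^+ 2) ^+ (n + 2) * expR (- (t ^+ 2 / 50)))).
  by rewrite addn2 [_ ^+ n.+2]exprS; ring.
apply: ler_pM.
- exact: mulr_ge0.
- by apply: mulr_ge0 => //; apply: mulr_ge0 => //; rewrite exprn_ge0// ltW.
- by rewrite ler_wpM2r// lerDl.
- by rewrite ler_wpM2l// ler_wpM2r// ler_weXn2l// leq_add2l.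
Qed.

End Approximation.

(** * Norms, and the excess coefficient *)

Section Norm.
Variables (R : realType) (N : nat).
Implicit Types (a b c : 'rV[R]_N).

Lemma dotC a b : dot a b = dot b a.
Proof. by apply: eq_bigr => k _; rewrite mulrC. Qed.

Lemma dotDl a b c : dot (a + b) c = dot a c + dot b c.
Proof. by rewrite /dot -big_split; apply: eq_bigr => k _; rewrite mxE mulrDl. Qed.

Lemma dotZl (x : R) a b : dot (x *: a) b = x * dot a b.
Proof. by rewrite /dot mulr_sumr; apply: eq_bigr => k _; rewrite mxE mulrA. Qed.

Lemma dotBl a b c : dot (a - b) c = dot a c - dot b c.
Proof. by rewrite dotDl -scaleN1r dotZl mulN1r. Qed.

Lemma dot_suml n (F : 'I_n -> 'rV[R]_N) b :
  dot (\sum_i F i) b = \sum_i dot (F i) b.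
Proof.
elim/big_rec2: _ => [|i y x _ <-]; last by rewrite dotDl.
by rewrite /dot big1// => k _; rewrite mxE mul0r.
Qed.

Lemma dot_ge0 a : 0 <= dot a a.
Proof. by apply: sumr_ge0 => k _; rewrite -expr2 sqr_ge0. Qed.

Lemma vnorm_ge0 a : 0 <= vnorm a. Proof. exact: sqrtr_ge0. Qed.

Lemma vnorm_sqr a : vnorm a ^+ 2 = dot a a.
Proof. by rewrite sqr_sqrtr// dot_ge0. Qed.

Lemma cauchy_schwarz a b : `|dot a b| <= vnorm a * vnorm b.
Proof.
have h : dot a b ^+ 2 <= dot a a * dot b b.
  have [b0|b0] := eqVneq (dot b b) 0.
    have z k : b 0 k = 0.
      move/eqP: b0; rewrite psumr_eq0 => [|i _]; last by rewrite -expr2 sqr_ge0.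
      by move/allP/(_ k); rewrite mem_index_enum mulf_eq0 orbb => /(_ isT)/eqP.
    by rewrite b0 mulr0 /dot big1 ?expr0n// => k _; rewrite z mulr0.
  have bp : 0 < dot b b by rewrite lt_def b0 dot_ge0.
  have := dot_ge0 (dot b b *: a - dot a b *: b).
  rewrite dotBl !dotZl ![dot _ (_ - _)]dotC !dotBl !dotZl [dot b a]dotC.
  have -> : dot b b * (dot b b * dot a a - dot a b * dot a b) -
      dot a b * (dot b b * dot a b - dot a b * dot b b) =
      dot b b * (dot a a * dot b b - dot a b ^+ 2) by ring.
  by rewrite pmulr_rge0// subr_ge0.
rewrite -ler_sqr ?nnegrE ?mulr_ge0 ?vnorm_ge0//.
by rewrite real_normK ?num_real// exprMn !vnorm_sqr.
Qed.

Lemma vnormZ (x : R) a : vnorm (x *: a) = `|x| * vnorm a.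
Proof.
rewrite /vnorm dotZl dotC dotZl mulrA -expr2 sqrtrM ?sqr_ge0//.
by rewrite sqrtr_sqr.
Qed.

Lemma vnormD a b : vnorm (a + b) <= vnorm a + vnorm b.
Proof.
rewrite -ler_sqr ?nnegrE ?addr_ge0 ?vnorm_ge0//.
rewrite vnorm_sqr dotDl ![dot _ (a + b)]dotC !dotDl sqrrD !vnorm_sqr [dot b a]dotC.
have := le_trans (ler_norm _) (cauchy_schwarz a b).
by rewrite -mulr_natl; lra.
Qed.

Lemma vnormN a : vnorm (- a) = vnorm a.
Proof. by rewrite -scaleN1r vnormZ normrN normr1 mul1r. Qed.

Lemma vnorm_sum n (F : 'I_n -> 'rV[R]_N) : vnorm (\sum_i F i) <= \sum_i vnorm (F i).
Proof.
elim/big_rec2: _ => [|i y x _ h].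
  by rewrite /vnorm /dot big1 ?sqrtr0// => k _; rewrite mxE mul0r.
by apply: le_trans (vnormD _ _) _; rewrite lerD2l.
Qed.

Lemma vnorm_dist a b : `|vnorm a - vnorm b| <= vnorm (a - b).
Proof.
rewrite ler_norml; apply/andP; split.
  have := vnormD a (b - a); rewrite addrC subrK -[b - a]opprB vnormN; lra.
by have := vnormD b (a - b); rewrite addrC subrK; lra.
Qed.

End Norm.

Section NearHermite.
Variable R : realType.
Local Notation om := (omega R).

(** The pointwise bound is squared and summed with the weight 1 / (1 + t^2); the fourth
root of omega in both vectors provides the mesh of the sum. *)
Lemma vnorm_windowed_Psi (b : bool) j c : exists C, 0 <= C /\
  forall N w m, balanced c N w m ->
  vnorm (windowed_Psi R N w m b j - Psi R N (j.*2 + b)) <= C * om N.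
Proof.
have [C [C0 hC]] := windowed_Psi_pointwise R b j c.
exists (4 * C); split; first exact: mulr_ge0.
move=> N w m bal; have {}hC := hC N w m bal.
have N2 : (2 <= N)%N by case: bal; lia.
have O0 := om_ge0 R N.
have q0 : 0 <= 4 * C * om N by apply: mulr_ge0 => //; apply: mulr_ge0.
rewrite -[leRHS](ger0_norm q0) -sqrtr_sqr; apply: ler_wsqrtr.
apply: (@le_trans _ _ ((C * om N) ^+ 2 * (step R N * \sum_(l < N) (1 + node R l ^+ 2)^-1))).
  rewrite /dot !mulr_sumr; apply: ler_sum => l _; rewrite !mxE -!expr2.
  have := hC l; rewrite !mxE; set X := _ - _; set Z := 1 + node R l ^+ 2 => h.
  have Z1 : 1 <= Z by rewrite lerDl sqr_ge0.
  have Z0 : 0 < Z by apply: lt_le_trans Z1.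
  rewrite -[X ^+ 2]real_normK ?num_real//.
  have r0 : 0 <= om N `^ 4^-1 by exact: powR_ge0.
  have p0 : 0 <= C * om N by apply: mulr_ge0.
  have h2 : `|X| ^+ 2 <= (C * om N * (om N `^ 4^-1 / Z)) ^+ 2.
    rewrite lerXn2r ?nnegrE//; apply: mulr_ge0 => //; rewrite divr_ge0// ltW//.
  apply: le_trans h2 _; rewrite exprMn ler_wpM2l ?sqr_ge0//.
  rewrite -om_root4 expr_div_n expr2 ler_wpM2l ?mulr_ge0//.
  by rewrite lef_pV2 ?posrE ?exprn_gt0// expr2 ler_peMl// ltW.
apply: le_trans (ler_wpM2l (sqr_ge0 _) (sum_inv_le R N2)) _.
rewrite [leRHS](_ : _ = (C * om N) ^+ 2 * 16); last by ring.
by rewrite ler_wpM2l ?sqr_ge0// ler_nat.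
Qed.

Lemma vnorm_Psi n : dominated om (fun N => vnorm (Psi R N n) - 1).
Proof.
apply: dominated_le (dominated_abs (dot_Psi R n n)) _; exists 0%N => N _.
rewrite eqxx -vnorm_sqr -[X in _ <= `|_ - X|](expr1n _ 2) subr_sqr normrM.
by rewrite ler_peMr// ger0_norm ?lerDr ?vnorm_ge0// addr_ge0 ?vnorm_ge0.
Qed.

Lemma vnorm_Psi_bounded n : dominated (fun=> 1) (fun N => vnorm (Psi R N n)).
Proof.
have := dominated_add (dominated_om_bounded (vnorm_Psi n)) (dominated_const 1).
by apply: dominated_near; exists 0%N => N _; rewrite subrK.
Qed.

(** At the height Y of w, which is of order 1/omega, the top polynomial is positive and
at least a multiple of Y^D, while the others are O(Y^(D-1)). The top relation puts
x D on both sides with opposite signs, so that no cancellation can occur and x D is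
at most a multiple of the lower part divided by Y^D. The case rho = 0 gives x D = 0. *)
Lemma top_coef_bound (b : bool) D c : (0 < D)%N -> exists C, exists N0, 0 <= C /\
  forall N w m, balanced c N w m -> (N0 <= N)%N -> forall x : nat -> R,
  top_relation N w b D x ->
  `|x D| <= C * om N * \sum_(j < D) `|x j|.
Proof.
case: D => // d _.
have [Y0 [Y01 low]] := poly_lower (size_half_herm R b d.+1) (half_herm_lead_gt0 R b d.+1).
set ell := (half_herm R b d.+1)`_d.+1 in low *.
have ell0 : 0 < ell by exact: half_herm_lead_gt0.
have up (j : 'I_d.+1) : exists K, 0 <= K /\ forall y, 1 <= y ->
    `|(half_herm R b j).[y]| <= K * y ^+ d.
  apply: poly_upper; apply: leq_trans (size_half_herm R b j) _; exact: ltn_ord.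
have [K hK] := choice up.
pose M := \sum_(j < d.+1) kappa R (j.*2 + b) * K j.
have M0 : 0 <= M.
  by apply: sumr_ge0 => j _; rewrite mulr_ge0 ?(ltW (kappa_gt0 _ _))//; case: (hK j).
have k0 := kappa_gt0 R (d.+1.*2 + b).
have Y00 : 0 < Y0 by apply: lt_le_trans Y01.
have e0 : 0 < 4 / (49 * Y0) by rewrite divr_gt0// mulr_gt0.
have [N0 hN0] := om_eventually_le e0.
(* As sin^2 >= 1/49, the height is at least 4 / (49 omega); half of the leading
coefficient is lost in the lower bound for the top polynomial: 2 * 49 / 4 <= 25. *)
exists (25 * M / (kappa R (d.+1.*2 + b) * ell)), N0; split.
  by rewrite divr_ge0 ?mulr_ge0// ?(ltW k0) ?(ltW ell0).
move=> N w m bal hN x [rho [rho0]].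
have om0 : 0 < om N by apply: om_gt0; case: bal; lia.
set Y := height N w%:R.
have hs : 7^-1 <= halfsin N w%:R :> R.
  have [[_ _ _ _ m_le] _ _] := balanced_real R bal.
  apply: (halfsin_ge bal) => //; apply: le_trans m_le.
  by rewrite ler_pM2l// ler_nat ltnW// (balanced_lt bal).
have YY : 4 / 49 <= Y * om N.
  by rewrite /Y /height divfK ?gt_eqF//; nra.
have Yge : Y0 <= Y.
  have := hN0 N hN; rewrite ler_pdivlMr ?mulr_gt0// => h.
  by rewrite -(ler_pM2r om0); move: h YY; lra.
have Y1 : 1 <= Y by apply: le_trans Yge.
have Ypos : 0 < Y by apply: lt_le_trans Y1.
rewrite big_ord_recr /=; set S := \sum_(j < d.+1) x j * _.
have lowY := low Y Yge; set BY := (half_herm R b d.+1).[Y] in lowY *.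
have BY0 : 0 < BY by apply: lt_le_trans lowY; rewrite mulr_gt0 ?exprn_gt0// divr_gt0.
set kap := kappa R (d.+1.*2 + b) in k0 *.
rewrite -/ell => eq.
have eq2 : `|x d.+1| * (kap * (ell + rho * BY)) = rho * `|S|.
  have : x d.+1 * (kap * (ell + rho * BY)) = - (rho * S).
    by move: eq; lra.
  move/(congr1 Num.norm); rewrite normrM normrN [`|rho * _|]normrM (ger0_norm rho0).
  by rewrite (@ger0_norm _ (kap * _))// mulr_ge0 ?(ltW k0)// addr_ge0 ?(ltW ell0)// mulr_ge0// ltW.
have b1 : `|x d.+1| * (kap * BY) <= `|S|.
  move: rho0; rewrite le_eqVlt => /orP[/eqP z|rp].
    move: eq2; rewrite -z !mul0r addr0 => /eqP.
    by rewrite mulf_eq0 (gt_eqF (mulr_gt0 k0 ell0)) orbF => /eqP ->; rewrite mul0r.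
  rewrite -(ler_pM2l rp) -eq2 mulrCA ler_wpM2l// mulrCA ler_wpM2l ?(ltW k0)//.
  by rewrite lerDr ltW.
have b2 : `|S| <= M * Y ^+ d * \sum_(j < d.+1) `|x j|.
  rewrite mulr_sumr; apply: le_trans (ler_norm_sum _ _ _) _.
  apply: ler_sum => j _; rewrite normrM mulrC ler_wpM2r//.
  rewrite normrM (gtr0_norm (kappa_gt0 _ _)).
  apply: (@le_trans _ _ (kappa R (j.*2 + b) * (K j * Y ^+ d))).
    by rewrite ler_wpM2l ?(ltW (kappa_gt0 _ _))//; apply: (hK j).2.
  rewrite mulrA ler_wpM2r ?exprn_ge0 ?(ltW Ypos)//.
  rewrite /M (bigD1 j)//= lerDl; apply: sumr_ge0 => i _.
  by rewrite mulr_ge0 ?(ltW (kappa_gt0 _ _))//; case: (hK i).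
set X := \sum_(j < d.+1) `|x j| in b2 *.
have X0 : 0 <= X by exact: sumr_ge0.
have b3 : `|x d.+1| * (kap * (ell / 2 * Y ^+ d.+1)) <= M * Y ^+ d * X.
  apply: le_trans b2; apply: le_trans b1; rewrite ler_wpM2l// ler_wpM2l//.
  exact: ltW.
have Yd : 0 < Y ^+ d by exact: exprn_gt0.
have b4 : `|x d.+1| * (kap * ell) * Y <= 2 * M * X.
  rewrite -(ler_pM2r Yd); move: b3; rewrite exprS.
  have -> : `|x d.+1| * (kap * (ell / 2 * (Y * Y ^+ d))) =
     `|x d.+1| * (kap * ell) * Y * Y ^+ d / 2 by field.
  by lra.
have kl : 0 < kap * ell by exact: mulr_gt0.
have -> : 25 * M / (kap * ell) * om N * X = 25 * (om N * (M * X)) / (kap * ell) by ring.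
rewrite ler_pdivlMr//.
have x0 : 0 <= `|x d.+1| * (kap * ell) by rewrite mulr_ge0// ltW.
have MX : 0 <= M * X by exact: mulr_ge0.
have b5 : `|x d.+1| * (kap * ell) * (4 / 49) <= `|x d.+1| * (kap * ell) * Y * om N.
  by rewrite -[leRHS]mulrA ler_wpM2l.
have b6 : `|x d.+1| * (kap * ell) * Y * om N <= 2 * (om N * (M * X)).
  have -> : 2 * (om N * (M * X)) = 2 * M * X * om N by ring.
  by rewrite ler_wpM2r// ltW.
have b7 : 0 <= om N * (M * X) by rewrite mulr_ge0// ltW.
move: b5 b6 b7; move: (om N * _) (`|x d.+1| * (kap * ell) * Y * om N) => t u.
move: (`|x d.+1| * _) => v.
by lra.
Qed.

End NearHermite.

(** * Induction over the basis *)

Section Assembly.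
Variable R : realType.
Local Notation om := (omega R).
Variable T : forall N : nat, nat -> 'rV[R]_N.
Hypothesis hT : forall N : nat, (2 <= N)%N -> minimal_hermite_basis (T N).

Lemma basis_orthonormal N m n : (m < N)%N -> (n < N)%N -> (2 <= N)%N ->
  dot (T N m) (T N n) = (m == n)%:R.
Proof. by move=> mN nN /hT[_ _ _ h _]; exact: h. Qed.

Section FixedIndex.
Variable n : nat.
(* From the rank N1 on the two cut-offs are balanced with the constant n + 10, which
absorbs all rounding. *)
Let b := odd n.
Let D := n./2.+1.
Let w N := ((N + n + 2) %/ 4)%N.
Let m N := ((N - b)./2)%N.
Let N1 := (100 * (n + 11))%N.

Lemma balanced_width N : (N1 <= N)%N -> balanced (n + 10) N (w N) (m N).
Proof. by rewrite /balanced /w /m /N1 /b; case: (odd n); split; lia. Qed.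

Definition expands N (c : nat -> R) : Prop :=
  T N n = \sum_(j < D.+1) c j *: windowed_Psi R N (w N) (m N) b j /\
  top_relation N (w N) b D c.

Lemma basis_expansion : exists c : nat -> nat -> R,
  forall N, (N1 <= N)%N -> expands N (c N).
Proof.
suff h N : exists c : nat -> R, (N1 <= N)%N -> expands N c.
  by have [c hc] := choice h; exists c.
have [hN|hN] := leqP N1 N; last by exists (fun=> 0).
have bal := balanced_width hN.
have N2 : (2 <= N)%N by move: hN; rewrite /N1; lia.
have nN : (n < N.-1)%N by move: hN; rewrite /N1; lia.
have nN' : (n < N)%N by lia.
have [_ hF _ hO hW] := hT N2.
have T0 : T N n != 0.
  apply/eqP => z; have := hO n n nN' nN'; rewrite eqxx z /dot big1 => [/esym/eqP|i _].
    by rewrite oner_eq0.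
  by rewrite mxE mul0r.
have wm : (w N < m N)%N := balanced_lt bal.
have [] := @window_expansion R N (w N) (m N) D b (T N n).
- by move: hN; rewrite /w /N1; lia.
- exact: wm.
- by rewrite /m /b; case: (odd n); lia.
- by move: hN; rewrite /w /m /D /b /N1; have := odd_double_half n; case: (odd n); lia.
- have ww : `|(w N)%:R| <= (w N)%:R :> R by rewrite ger0_norm.
  by have /andP[] := window_decay bal ww.
- move=> l; rewrite (dft_eigen_real (hF n nN)) -/b /D.
  by rewrite -[n./2.+2]addn2 exprD sqrrN expr1n mulr1.
- move=> l hl; apply: width_vanish => //; apply: le_lt_trans hl.
  by rewrite lez_nat; exact: hW.
by move=> c hc; exists c.
Qed.

Lemma vnorm_basis N : (N1 <= N)%N -> vnorm (T N n) = 1.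
Proof.
move=> hN; rewrite /vnorm basis_orthonormal ?eqxx ?sqrtr1//; move: hN; rewrite /N1; lia.
Qed.

Local Notation e j N := (windowed_Psi R N (w N) (m N) b j).
Local Notation P j N := (Psi R N (j.*2 + b)).

Lemma windowed_Psi_near j : dominated om (fun N => vnorm (e j N - P j N)).
Proof.
have [C [C0 h]] := vnorm_windowed_Psi R b j (n + 10); exists C, N1; split=> // N hN.
by rewrite ger0_norm ?vnorm_ge0// h//; exact: balanced_width.
Qed.

Lemma dot_windowed_Psi_Psi i j : dominated om (fun N => dot (e i N) (P j N) - (i == j)%:R).
Proof.
have h1 : dominated om (fun N => dot (e i N - P i N) (P j N)).
  apply: dominated_le (dominated_mull (windowed_Psi_near i) (vnorm_Psi_bounded R (j.*2 + b))) _.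
  by exists 0%N => N _; exact: cauchy_schwarz.
apply: dominated_near (dominated_add h1 (dot_Psi R (i.*2 + b) (j.*2 + b))).
exists 0%N => N _; rewrite dotBl eqn_add2r -!muln2 eqn_mul2r /=; ring.
Qed.

Lemma dot_windowed_Psi i j : dominated om (fun N => dot (e i N) (e j N) - (i == j)%:R).
Proof.
have bd : dominated (fun=> 1) (fun N => vnorm (e i N)).
  have := dominated_add (dominated_om_bounded (windowed_Psi_near i))
    (vnorm_Psi_bounded R (i.*2 + b)).
  move/dominated_le; apply; exists 0%N => N _; rewrite ger0_norm ?vnorm_ge0//.
  by apply: le_trans (vnormD _ _); rewrite subrK.
have h1 : dominated om (fun N => dot (e i N) (e j N - P j N)).
  apply: dominated_le (dominated_mulr bd (windowed_Psi_near j)) _.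
  by exists 0%N => N _; exact: cauchy_schwarz.
apply: dominated_near (dominated_add h1 (dot_windowed_Psi_Psi i j)).
exists 0%N => N _; rewrite [dot _ (_ - _)]dotC dotBl [dot (P j N) _]dotC [dot (e j N) _]dotC; ring.
Qed.

Variable c : nat -> nat -> R.
Hypothesis hc : forall N, (N1 <= N)%N -> expands N (c N).

(** The Gram matrix of the windowed vectors is close to the identity, so that half of
the sum of the squared coefficients is bounded by the squared norm 1 of T n. *)
Lemma coef_bounded j : (j <= D)%N -> dominated (fun=> 1) (fun N => c N j).
Proof.
move=> jD.
pose del (i k : 'I_D.+1) N := dot (e i N) (e k N) - (i == k)%:R.
have hdel : dominated om (fun N => \sum_i \sum_k `|del i k N|).
  apply: dominated_sum => [N|i _]; first exact: om_ge0.
  apply: dominated_sum => [N|k _]; first exact: om_ge0.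
  apply: dominated_abs; exact: (dot_windowed_Psi i k).
have half0 : 0 < 2^-1 :> R by rewrite invr_gt0.
have [N0 small] := dominated_om_small half0 hdel.
exists 2, (maxn N0 N1); split=> // N; rewrite geq_max => /andP[h0 h1].
have {small} small := le_trans (ler_norm _) (small N h0).
have [eT _] := hc h1.
pose S := \sum_(i < D.+1) c N i ^+ 2.
have cS (i : 'I_D.+1) : c N i ^+ 2 <= S.
  by rewrite /S (bigD1 i)//= lerDl sumr_ge0// => k _; rewrite sqr_ge0.
have S0 : 0 <= S by apply: sumr_ge0 => k _; rewrite sqr_ge0.
have one : 1 = \sum_(i < D.+1) \sum_(k < D.+1) c N i * (c N k * (del i k N + (i == k)%:R)).
  transitivity (dot (T N n) (T N n)).
    by rewrite -vnorm_sqr vnorm_basis// expr1n.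
  rewrite {1}eT dot_suml; apply: eq_bigr => i _; rewrite dotZl eT dotC dot_suml mulr_sumr.
  by apply: eq_bigr => k _; rewrite dotZl dotC /del subrK.
have split_sum : 1 = S + \sum_(i < D.+1) \sum_(k < D.+1) c N i * c N k * del i k N.
  rewrite one /S -big_split; apply: eq_bigr => i _ /=.
  under eq_bigr => k _ do rewrite mulrDr mulrDr mulrA.
  rewrite big_split /= addrC; congr (_ + _).
  rewrite (bigD1 i)//= eqxx mulr1 big1 ?addr0 ?expr2// => k ki.
  by rewrite eq_sym (negbTE ki) !mulr0.
have bound : `|\sum_(i < D.+1) \sum_(k < D.+1) c N i * c N k * del i k N| <= S / 2.
  apply: le_trans (ler_wpM2l S0 small); rewrite mulr_sumr.
  apply: le_trans (ler_norm_sum _ _ _) _; apply: ler_sum => i _; rewrite mulr_sumr.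
  apply: le_trans (ler_norm_sum _ _ _) _; apply: ler_sum => k _.
  rewrite normrM ler_wpM2r// normrM.
  have hi := cS i; have hk := cS k.
  rewrite -[c N i ^+ 2]real_normK ?num_real// in hi.
  rewrite -[c N k ^+ 2]real_normK ?num_real// in hk.
  by have := sqr_ge0 (`|c N i| - `|c N k|); rewrite sqrrB -mulr_natl; lra.
have S2 : S <= 2 by move: bound; rewrite ler_norml; lra.
rewrite mulr1 -[leRHS]ger0_norm// -ler_sqr ?nnegrE// !real_normK ?num_real//.
have := cS (Ordinal (jD : (j < D.+1)%N)) => /=; lra.
Qed.

Lemma coef_top : dominated om (fun N => c N D).
Proof.
have D0 : (0 < D)%N by [].
have [C [N0 [C0 h]]] := top_coef_bound R b (n + 10) D0.
have bd : dominated (fun=> 1) (fun N => \sum_(j < D) `|c N j|).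
  apply: dominated_sum => // j _; apply: dominated_abs; apply: coef_bounded.
  exact: ltnW (ltn_ord j).
have om_dom : dominated om om.
  by exists 1, 0%N; split=> // N _; rewrite mul1r ger0_norm ?om_ge0.
apply: dominated_le (dominated_mull (dominated_scale C om_dom) bd) _.
exists (maxn N0 N1) => N; rewrite geq_max => /andP[h0 h1].
have [_ top] := hc h1; exact: (h N _ _ (balanced_width h1) h0 _ top).
Qed.

Lemma dot_basis_Psi i : (i <= D)%N ->
  dominated om (fun N => dot (T N n) (P i N) - c N i).
Proof.
move=> iD.
have h : dominated om (fun N => \sum_(j < D.+1) c N j * (dot (e j N) (P i N) - (val j == i)%:R)).
  apply: dominated_sum => [N|j _]; first exact: om_ge0.
  apply: dominated_mulr (dot_windowed_Psi_Psi j i); apply: coef_bounded.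
  by rewrite -ltnS.
apply: dominated_near h; exists N1 => N hN; have [eT _] := hc hN.
rewrite {1}eT dot_suml.
under eq_bigr => j _ do rewrite mulrBr.
rewrite big_split /= sumrN; congr (_ - _).
  by apply: eq_bigr => j _; rewrite dotZl.
rewrite (bigD1 (Ordinal (iD : (i < D.+1)%N)))//= eqxx mulr1 big1 ?addr0// => j ji.
by rewrite (_ : (val j == i) = false) ?mulr0//; apply: contraNF ji => /eqP h; apply/eqP/val_inj.
Qed.

Let sgn k N := dot (T N k) (Psi R N k) < 0.

(** T n is orthogonal to the earlier basis vector, and that vector is within O(omega)
of the sampled Hermite function up to a sign. *)
Lemma coef_lower (i : nat) : (i < n./2)%N ->
  dominated om (fun N => vnorm ((-1) ^+ sgn (i.*2 + b) N *: T N (i.*2 + b) - P i N)) ->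
  dominated om (fun N => c N i).
Proof.
move=> iD ih.
have h1 : dominated om (fun N => dot (T N n) (P i N)).
  apply: dominated_le ih _; exists N1 => N hN.
  have k : (i.*2 + b < n)%N by rewrite -[X in (_ < X)%N]odd_double_half -/b; lia.
  have z : dot (T N n) (T N (i.*2 + b)) = 0.
    rewrite basis_orthonormal; [|by move: hN; rewrite /N1; lia..].
    by rewrite (gtn_eqF k).
  set s := (-1) ^+ _.
  have -> : dot (T N n) (P i N) = - dot (T N n) (s *: T N (i.*2 + b) - P i N).
    by rewrite [dot _ (_ - _)]dotC dotBl dotZl [dot (T N (_ + _)) _]dotC z mulr0 sub0r opprK dotC.
  rewrite normrN; apply: le_trans (cauchy_schwarz _ _) _.
  by rewrite vnorm_basis// mul1r.
have iD' : (i <= D)%N by rewrite /D; lia.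
apply: dominated_near (dominated_sub h1 (dot_basis_Psi iD')).
by exists 0%N => N _; ring.
Qed.

(** Every coefficient but the one of index n/2 is O(omega), hence T n is nearly a multiple
of the sampled Hermite function; both have norm nearly 1, so the multiple is nearly
a sign. *)
Lemma basis_near_Psi :
  (forall i, (i < n./2)%N ->
    dominated om (fun N => vnorm ((-1) ^+ sgn (i.*2 + b) N *: T N (i.*2 + b) - P i N))) ->
  dominated om (fun N => vnorm ((-1) ^+ sgn n N *: T N n - Psi R N n)).
Proof.
move=> ih; set d := n./2.
have nE : (d.*2 + b)%N = n by rewrite addnC odd_double_half.
have dD : (d <= D)%N by rewrite /D.
have small (j : 'I_D.+1) : val j != d -> dominated om (fun N => c N j).
  move=> jd; have := ltn_ord j; rewrite ltnS leq_eqVlt => /orP[/eqP ->|].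
    exact: coef_top.
  by rewrite ltnS leq_eqVlt (negbTE jd) /= => jl; apply: coef_lower => //; exact: ih.
have rest : dominated om (fun N => vnorm (T N n - c N d *: P d N)).
  have h : dominated om (fun N => \sum_(j < D.+1)
      (`|c N j| * vnorm (e j N - P j N) + (val j != d)%:R * `|c N j| * vnorm (P j N))).
    apply: dominated_sum => [N|j _]; first exact: om_ge0.
    apply: dominated_add.
      apply: dominated_mulr (windowed_Psi_near j); apply: dominated_abs; apply: coef_bounded.
      by rewrite -ltnS.
    apply: dominated_mull (vnorm_Psi_bounded R _).
    have [jd|jd] := eqVneq (val j) d.
      by exists 0, 0%N; split=> // N _; rewrite mul0r normr0 mul0r.
    by apply: dominated_scale; apply: dominated_abs; exact: small.
  apply: dominated_le h _; exists N1 => N hN; have [eT _] := hc hN.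
  rewrite ger0_norm ?vnorm_ge0//.
  have -> : T N n - c N d *: P d N = \sum_(j < D.+1)
      (c N j *: (e j N - P j N) + ((val j != d)%:R * c N j) *: P j N).
    rewrite big_split /=.
    under eq_bigr => j _ do rewrite scalerBr.
    rewrite big_split /= -eT -addrA; congr (_ + _).
    rewrite sumrN -sumrN -big_split /= (bigD1 (Ordinal (dD : (d < D.+1)%N)))//=.
    rewrite eqxx mul0r scale0r addr0 big1 ?addr0// => j jd.
    have jd' : val j != d by apply: contra jd => /eqP h2; apply/eqP/val_inj.
    by rewrite jd' mul1r addNr.
  apply: le_trans (vnorm_sum _) _; apply: ler_sum => j _.
  by apply: le_trans (vnormD _ _) _; rewrite !vnormZ normrM normr_nat.
rewrite nE in rest.
have abs1 : dominated om (fun N => `|c N d| - 1).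
  have h := dominated_add rest (dominated_mulr (dominated_abs (coef_bounded dD))
    (dominated_abs (vnorm_Psi R n))).
  apply: dominated_le h _; exists N1 => N hN.
  have h1 := vnorm_dist (T N n) (c N d *: Psi R N n).
  rewrite vnormZ vnorm_basis// in h1.
  have -> : `|c N d| - 1 = - (1 - `|c N d| * vnorm (Psi R N n)) -
     `|c N d| * (vnorm (Psi R N n) - 1) by ring.
  apply: le_trans (ler_normB _ _) _; rewrite normrN lerD//.
  by rewrite normrM normr_id.
have sg : exists N0, forall N, (N0 <= N)%N -> (-1) ^+ sgn n N * c N d = `|c N d|.
  have q0 : 0 < 4^-1 :> R by rewrite invr_gt0.
  have hd := dot_basis_Psi dD; rewrite nE in hd.
  have [Na ha] := dominated_om_small q0 hd.
  have [Nb hb] := dominated_om_small q0 abs1.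
  exists (maxn Na Nb) => N; rewrite geq_max => /andP[/ha h1 /hb h2].
  move: h1 h2; rewrite /sgn; set x := dot _ _; set y := c N d => h1 h2.
  have [y0|y0] := leP 0 y; rewrite ?(ger0_norm y0) ?(ltr0_norm y0) in h2 *.
    rewrite (_ : (x < 0) = false) ?mul1r//; apply/negbTE; rewrite -leNgt.
    by move: h1 h2; rewrite !ler_norml; lra.
  rewrite (_ : (x < 0) = true) ?expr1 ?mulN1r//.
  by move: h1 h2; rewrite !ler_norml; lra.
have fin := dominated_add rest (dominated_mull (dominated_abs abs1) (vnorm_Psi_bounded R n)).
apply: dominated_le fin _; have [N0 hs] := sg; exists N0 => N /hs s1.
rewrite ger0_norm ?vnorm_ge0//; set s := (-1) ^+ _ in s1 *.
have -> : s *: T N n - Psi R N n = s *: (T N n - c N d *: Psi R N n) + (`|c N d| - 1) *: Psi R N n.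
  by rewrite scalerBr scalerA s1 scalerBl scale1r addrA subrK.
apply: le_trans (vnormD _ _) _; rewrite !vnormZ.
have -> : `|s| = 1 by rewrite /s normrX normrN1 expr1n.
by rewrite mul1r.
Qed.

End FixedIndex.

Lemma basis_close n : dominated om (fun N =>
  vnorm ((-1) ^+ (dot (T N n) (Psi R N n) < 0)%R *: T N n - Psi R N n)).
Proof.
elim/ltn_ind: n => n IH; have [c hc] := basis_expansion n.
apply: (basis_near_Psi hc) => i hi; apply: IH.
by rewrite -[X in (_ < X)%N]odd_double_half; lia.
Qed.

End Assembly.

Theorem theorem1p7 (R : realType) (T : forall N : nat, nat -> 'rV[R]_N)
  (hT : forall N : nat, (2 <= N)%N -> minimal_hermite_basis (T N)) :
  exists s : nat -> nat -> bool,
    forall (n : nat) (eps : R), 0 < eps ->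
      (fun N : nat => vnorm ((-1) ^+ s N n *: T N n - Psi R N n) : R^o)
      =O_\oo (fun N : nat => N%:R `^ (-1 + eps) : R^o).
Proof.
exists (fun N n => dot (T N n) (Psi R N n) < 0) => n eps eps0.
have [C [N0 [C0 h]]] := basis_close hT n.
(* The constant 8 bounds 2 pi, and the summand 1 makes the constant positive. *)
apply/eqO_exP; exists (8 * C + 1); first by rewrite ltr_wpDl// mulr_ge0.
exists N0.+1 => // N /= hN.
have N1 : 1 <= N%:R :> R by rewrite ler1n (leq_trans _ hN).
have Np : 0 < N%:R :> R by apply: lt_le_trans N1.
apply: le_trans (h N (ltnW hN)) _.
rewrite [`|_ `^ _|]ger0_norm ?powR_ge0//.
have le1 : N%:R^-1 <= N%:R `^ (-1 + eps) :> R.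
  rewrite -(powR_inv1 (ltW Np)); apply: ler_powR => //; lra.
have le2 : omega R N <= 8 * N%:R^-1.
  by rewrite /omega ler_pM2r ?invr_gt0//; have := @pi_lt4 R; lra.
have p0 : 0 <= N%:R `^ (-1 + eps) :> R by exact: powR_ge0.
apply: le_trans (ler_wpM2l C0 le2) _.
rewrite mulrA [C * 8]mulrC.
apply: (@le_trans _ _ (8 * C * N%:R `^ (-1 + eps))).
  by rewrite ler_wpM2l// mulr_ge0.
by rewrite ler_wpM2r// lerDl.
Qed.
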